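(* There is a universal constant $C>0$ such that the following holds. Let $U$ be a unitary and $\Pi,\widetilde\Pi$ orthogonal projectors on a finite-dimensional Hilbert space, let $\gamma>1$ and $\delta,\varepsilon\in(0,\frac12)$, and let $\widetilde\Pi U\Pi=\sum_i\varsigma_i|w_i\rangle\langle v_i|$ be a singular value decomposition. Then there exist an odd $m\le C\frac{\gamma}{\delta}\log(\gamma/\varepsilon)$ and $\Phi\in\mathbb{R}^m$ such that $$\left(\langle+|\otimes\widetilde\Pi_{\le\frac{1-\delta}{\gamma}}\right)\left(|0\rangle\langle0|\otimes U_\Phi+|1\rangle\langle1|\otimes U_{-\Phi}\right)\left(|+\rangle\otimes\Pi_{\le\frac{1-\delta}{\gamma}}\right)=\sum_{i:\varsigma_i\le\frac{1-\delta}{\gamma}}\tilde\varsigma_i|w_i\rangle\langle v_i|,$$ where $\tilde\varsigma_i=0$ if $\varsigma_i=0$ and $\left|\frac{\tilde\varsigma_i}{\gamma\varsigma_i}-1\right|\le\varepsilon$ if $\varsigma_i>0$.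
   Context: Singular value decomposition: $(|v_i\rangle)_{i\le d}$ orthonormal basis of $\mathrm{img}\,\Pi$, $(|w_i\rangle)_{i\le\tilde d}$ orthonormal basis of $\mathrm{img}\,\widetilde\Pi$, $\varsigma_i\ge0$ for $i\le\min(d,\tilde d)$, and $\varsigma_i:=0$ for larger indices. Threshold projectors: $\Pi_{\le t}$ is the orthogonal projector onto $\mathrm{span}\{|v_i\rangle:\varsigma_i\le t\}$ and $\widetilde\Pi_{\le t}$ onto $\mathrm{span}\{|w_i\rangle:\varsigma_i\le t\}$. $|+\rangle=(|0\rangle+|1\rangle)/\sqrt2$ on an extra qubit. For odd $m$, $U_\Phi:=e^{i\phi_1(2\widetilde\Pi-I)}U\prod_{j=1}^{(m-1)/2}\left(e^{i\phi_{2j}(2\Pi-I)}U^\dagger e^{i\phi_{2j+1}(2\widetilde\Pi-I)}U\right)$ (left to right). *)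

(* Defs.v *)
From Stdlib Require Import Reals Lra Lia ClassicalEpsilon Factorial.
Open Scope R_scope.

Record C := mkC { Re : R; Im : R }.
Definition RtoC (x : R) : C := mkC x 0.
Definition C0 : C := RtoC 0.
Definition C1 : C := RtoC 1.
Definition Ci : C := mkC 0 1.
Definition Cadd (a b : C) : C := mkC (Re a + Re b) (Im a + Im b).
Definition Copp (a : C) : C := mkC (- Re a) (- Im a).
Definition Cmul (a b : C) : C :=
  mkC (Re a * Re b - Im a * Im b) (Re a * Im b + Im a * Re b).
Definition Cconj (a : C) : C := mkC (Re a) (- Im a).

(** limit of a complex sequence (entrywise real/imaginary convergence);
    defined by choice, meaningful when the sequence converges *)
Definition lim_C (u : nat -> C) : C :=
  epsilon (inhabits C0)
    (fun l => Un_cv (fun k => Re (u k)) (Re l) /\ Un_cv (fun k => Im (u k)) (Im l)).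

Fixpoint csum (n : nat) (f : nat -> C) : C :=
  match n with O => C0 | S k => Cadd (csum k f) (f k) end.

(** * Vectors and matrices (entries outside the relevant range are ignored) *)
Definition Vec := nat -> C.
Definition Mat := nat -> nat -> C.

Definition mzero : Mat := fun _ _ => C0.
Definition idm : Mat := fun i j => if Nat.eqb i j then C1 else C0.
Definition madd (A B : Mat) : Mat := fun i j => Cadd (A i j) (B i j).
Definition mopp (A : Mat) : Mat := fun i j => Copp (A i j).
Definition mscale (c : C) (A : Mat) : Mat := fun i j => Cmul c (A i j).
Definition adjoint (A : Mat) : Mat := fun i j => Cconj (A j i).
Definition mmul (k : nat) (A B : Mat) : Mat :=
  fun i j => csum k (fun l => Cmul (A i l) (B l j)).
Definition msum (k : nat) (F : nat -> Mat) : Mat :=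
  fun i j => csum k (fun l => F l i j).
Definition mat_eq (r c : nat) (A B : Mat) : Prop :=
  forall i j, (i < r)%nat -> (j < c)%nat -> A i j = B i j.

Definition mvmul (n : nat) (A : Mat) (x : Vec) : Vec :=
  fun i => csum n (fun l => Cmul (A i l) (x l)).
Definition inner (n : nat) (u v : Vec) : C :=
  csum n (fun l => Cmul (Cconj (u l)) (v l)).
Definition outer (u v : Vec) : Mat := fun i j => Cmul (u i) (Cconj (v j)).

Definition kron (r2 c2 : nat) (A B : Mat) : Mat :=
  fun i j => Cmul (A (i / r2)%nat (j / c2)%nat) (B (i mod r2)%nat (j mod c2)%nat).

Definition unitary (N : nat) (U : Mat) : Prop :=
  mat_eq N N (mmul N (adjoint U) U) idm /\ mat_eq N N (mmul N U (adjoint U)) idm.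

Definition orth_proj (N : nat) (P : Mat) : Prop :=
  mat_eq N N (mmul N P P) P /\ mat_eq N N (adjoint P) P.

Definition in_image (N : nat) (P : Mat) (x : Vec) : Prop :=
  exists y : Vec, forall i, (i < N)%nat -> x i = mvmul N P y i.

Definition orthonormal_basis_of_img (N : nat) (P : Mat) (d : nat) (v : nat -> Vec) : Prop :=
  (forall i j, (i < d)%nat -> (j < d)%nat ->
      inner N (v i) (v j) = (if Nat.eqb i j then C1 else C0)) /\
  (forall i, (i < d)%nat -> in_image N P (v i)) /\
  (forall x, in_image N P x ->
      exists c : nat -> C, forall k, (k < N)%nat ->
        x k = csum d (fun i => Cmul (c i) (v i k))).

(** singular values extended by 0 beyond index min(d, d~) *)
Definition sig_ext (r : nat) (s : nat -> R) (i : nat) : R :=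
  if Nat.ltb i r then s i else 0.

(** orthogonal projector onto span{ u_i : i < d, s'_i <= t }, for an
    orthonormal family u: sum of |u_i><u_i| over those i *)
Definition thr_proj (d : nat) (u : nat -> Vec) (s' : nat -> R) (t : R) : Mat :=
  msum d (fun i => if Rle_dec (s' i) t then outer (u i) (u i) else mzero).

Fixpoint mpow (N : nat) (A : Mat) (k : nat) : Mat :=
  match k with O => idm | S k' => mmul N (mpow N A k') A end.
Definition mexp_partial (N : nat) (A : Mat) (k : nat) : Mat :=
  msum (S k) (fun l => mscale (RtoC (/ INR (fact l))) (mpow N A l)).
Definition mexp (N : nat) (A : Mat) : Mat :=
  fun i j => lim_C (fun k => mexp_partial N A k i j).

Definition phase (N : nat) (phi : R) (P : Mat) : Mat :=
  mexp N (mscale (Cmul Ci (RtoC phi)) (madd (mscale (RtoC 2) P) (mopp idm))).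

Fixpoint mprod (N : nat) (k : nat) (F : nat -> Mat) : Mat :=
  match k with O => idm | S k' => mmul N (mprod N k' F) (F k) end.

Definition UPhi (N : nat) (U P Pt : Mat) (m : nat) (Phi : nat -> R) : Mat :=
  let phi := fun j : nat => Phi (j - 1)%nat in
  mmul N (mmul N (phase N (phi 1%nat) Pt) U)
    (mprod N ((m - 1) / 2)%nat (fun j =>
       mmul N (mmul N (mmul N (phase N (phi (2 * j)%nat) P) (adjoint U))
                           (phase N (phi (2 * j + 1)%nat) Pt)) U)).

Definition ket0 : Mat := fun i j => if andb (Nat.eqb i 0) (Nat.eqb j 0) then C1 else C0.
Definition ket1 : Mat := fun i j => if andb (Nat.eqb i 1) (Nat.eqb j 0) then C1 else C0.
Definition ketplus : Mat :=
  fun i j => if andb (Nat.leb i 1) (Nat.eqb j 0) then RtoC (/ sqrt 2) else C0.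
Definition braplus : Mat := adjoint ketplus.
Definition proj0 : Mat := mmul 1 ket0 (adjoint ket0).
Definition proj1 : Mat := mmul 1 ket1 (adjoint ket1).

(* Main.v *)
From Stdlib Require Import Reals Lra Lia ZArith ClassicalEpsilon Factorial.
From mathcomp Require all_boot all_order all_algebra.
From mathcomp Require interval reals trigo Rstruct polyrcf complex.
From mathcomp Require ring lra zify.
Require Import Defs.
Open Scope R_scope.

(** Write [X] for [x^2].  On the plane attached to a singular value [x], the
    unitary and its adjoint act as the same reflection, and averaging over
    [Phi] and [-Phi] keeps the real part of the amplitude; so it suffices to
    produce phases whose amplitude at [x] has real part [gamma x R(X)], with
    [R] a polynomial within [eps] of 1 for [x <= (1 - delta)/gamma].

    Construction of [R]: with [x = sin phi], convolving the indicator of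
    [|sin| <= (1 - delta/2)/gamma] on an equispaced grid with a positive
    trigonometric kernel of degree [n = O(gamma/delta)] and variance [O(1/n^2)]
    gives a polynomial in [X] which is at least 2/3 below the threshold and at
    most 1/3 beyond [1/gamma].  The majority polynomial of [O(log(gamma/eps))]
    votes pushes these values to within [eps/gamma] of 1 and 0, which also
    makes [gamma x R(X)] at most 1 on all of [[0, 1]].

    Existence of phases: [1 - X (gamma R)^2] is nonnegative on [[0, 1]], so by
    Lukacs it equals [X a^2 + (1 - X) b^2]; hence [P = x (gamma R + i a)] and
    [Q = b] satisfy [|P|^2 + (1 - x^2) |Q|^2 = 1], and the phases are stripped
    one at a time, each lowering the degree by one. *)

(** * The qubit block and the exponential of an involution *)

Lemma C_ring_theory :
  ring_theory C0 C1 Cadd Cmul (fun a b => Cadd a (Copp b)) Copp eq.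
Proof.
  constructor; intros; repeat match goal with z : C |- _ => destruct z end;
    unfold Cadd, Cmul, Copp, C0, C1, RtoC; simpl; f_equal; ring.
Qed.
Add Ring C_ring : C_ring_theory.

Ltac C_components :=
  unfold Cconj, C1, C0, RtoC, Cmul, Cadd, Copp; simpl; f_equal; ring.

Lemma csum_ext n f g :
  (forall k, (k < n)%nat -> f k = g k) -> csum n f = csum n g.
Proof.
  induction n as [|n IH]; intros H; simpl; [reflexivity|].
  rewrite IH, H; auto.
Qed.

Lemma csum_scale n c f : csum n (fun k => Cmul c (f k)) = Cmul c (csum n f).
Proof. induction n as [|n IH]; simpl; [|rewrite IH]; ring. Qed.

Lemma csum_add n f g : csum n (fun k => Cadd (f k) (g k)) = Cadd (csum n f) (csum n g).
Proof. induction n as [|n IH]; simpl; [|rewrite IH]; ring. Qed.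

Lemma csum_split n k f : csum (n + k) f = Cadd (csum n f) (csum k (fun l => f (n + l)%nat)).
Proof.
  induction k as [|k IH]; simpl; [rewrite Nat.add_0_r; ring|].
  rewrite Nat.add_succ_r; simpl; rewrite IH; ring.
Qed.

Lemma block0 N l : (l < N)%nat -> (l / N)%nat = 0%nat /\ (l mod N)%nat = l.
Proof. intros; split; [apply Nat.div_small | apply Nat.mod_small]; assumption. Qed.

Lemma block1 N l : (l < N)%nat -> ((N + l) / N)%nat = 1%nat /\ ((N + l) mod N)%nat = l.
Proof.
  intros H; replace (N + l)%nat with (l + 1 * N)%nat by lia; split.
  - rewrite Nat.div_add by lia; rewrite Nat.div_small; auto.
  - rewrite Nat.Div0.mod_add; apply Nat.mod_small; auto.
Qed.

Definition half_sum (A B : Mat) : Mat := mscale (RtoC (/ 2)) (madd A B).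

Lemma sqrt2_inv_sq : Cmul (RtoC (/ sqrt 2)) (RtoC (/ sqrt 2)) = RtoC (/ 2).
Proof.
  unfold Cmul, RtoC; simpl; f_equal; [|ring].
  rewrite Rmult_0_l, Rminus_0_r, <- Rinv_mult, sqrt_sqrt; lra.
Qed.

(** Each qubit block is weighted by [1 / sqrt 2] twice, once from the bra and once from the ket,
    whence the factor [1 / 2] of [half_sum]; [proj0] and [proj1] are diagonal, so no cross term
    survives. *)
Lemma plus_block N A B V W i j : (i < N)%nat -> (j < N)%nat ->
  mmul (2 * N)
    (mmul (2 * N) (kron N N braplus A) (madd (kron N N proj0 V) (kron N N proj1 W)))
    (kron N N ketplus B) i j
  = mmul N (mmul N A (half_sum V W)) B i j.
Proof.
  intros Hi Hj.
  unfold mmul at 1.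
  replace (2 * N)%nat with (N + N)%nat by lia.
  rewrite csum_split.
  set (r := RtoC (/ sqrt 2)).
  assert (E0 : forall k, (k < N)%nat ->
    mmul (N + N) (kron N N braplus A) (madd (kron N N proj0 V) (kron N N proj1 W)) i k
    = Cmul r (mmul N A V i k)).
  { intros k Hk; unfold mmul at 1; rewrite csum_split.
    unfold mmul; rewrite <- csum_scale.
    rewrite (csum_ext N (fun l => Cmul (kron N N braplus A i (N + l)%nat) _)
              (fun _ => Cmul C0 C0)).
    2: { intros l Hl; unfold kron, madd.
         destruct (block0 N i Hi) as [-> ->], (block0 N k Hk) as [-> ->],
           (block1 N l Hl) as [-> ->].
         unfold proj0, proj1, mmul, ket0, ket1, adjoint; simpl; C_components. }
    rewrite csum_scale.
    replace (Cmul C0 _) with C0 by ring.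
    match goal with |- Cadd ?a C0 = ?b => replace (Cadd a C0) with a by ring end.
    apply csum_ext; intros l Hl; unfold kron, madd.
    destruct (block0 N i Hi) as [-> ->], (block0 N k Hk) as [-> ->],
      (block0 N l Hl) as [-> ->].
    unfold proj0, proj1, mmul, ket0, ket1, braplus, adjoint, ketplus, r; simpl.
    C_components. }
  assert (E1 : forall k, (k < N)%nat ->
    mmul (N + N) (kron N N braplus A) (madd (kron N N proj0 V) (kron N N proj1 W)) i (N + k)%nat
    = Cmul r (mmul N A W i k)).
  { intros k Hk; unfold mmul at 1; rewrite csum_split.
    unfold mmul; rewrite <- csum_scale.
    rewrite (csum_ext N (fun l => Cmul (kron N N braplus A i l) _)
              (fun _ => Cmul C0 C0)).
    2: { intros l Hl; unfold kron, madd.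
         destruct (block0 N i Hi) as [-> ->], (block1 N k Hk) as [-> ->],
           (block0 N l Hl) as [-> ->].
         unfold proj0, proj1, mmul, ket0, ket1, adjoint; simpl; C_components. }
    rewrite csum_scale.
    replace (Cmul C0 _) with C0 by ring.
    match goal with |- Cadd C0 ?a = ?b => replace (Cadd C0 a) with a by ring end.
    apply csum_ext; intros l Hl; unfold kron, madd.
    destruct (block0 N i Hi) as [-> ->], (block1 N k Hk) as [-> ->],
      (block1 N l Hl) as [-> ->].
    unfold proj0, proj1, mmul, ket0, ket1, braplus, adjoint, ketplus, r; simpl.
    C_components. }
  assert (EB : forall k, (k < N)%nat ->
    kron N N ketplus B k j = Cmul r (B k j) /\ kron N N ketplus B (N + k)%nat j = Cmul r (B k j)).
  { intros k Hk; unfold kron, ketplus.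
    destruct (block0 N j Hj) as [-> ->], (block0 N k Hk) as [-> ->],
      (block1 N k Hk) as [-> ->]; simpl; auto. }
  rewrite <- csum_add; apply csum_ext; intros k Hk.
  rewrite E0, E1 by assumption; destruct (EB k Hk) as [-> ->].
  unfold half_sum, mmul, mscale, madd.
  rewrite (csum_ext N (fun l => Cmul (A i l) (Cmul (RtoC (/ 2)) _))
     (fun l => Cmul (Cmul r r) (Cadd (Cmul (A i l) (V l k)) (Cmul (A i l) (W l k))))).
  2: { intros l _; unfold r; rewrite sqrt2_inv_sq; ring. }
  rewrite csum_scale, csum_add; ring.
Qed.

Fixpoint cpow (c : C) (k : nat) : C :=
  match k with O => C1 | S k' => Cmul (cpow c k') c end.

Definition parity_part (Z : Mat) (k : nat) : Mat := if Nat.even k then idm else Z.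

Lemma csum_idm_l n f j : (j < n)%nat -> csum n (fun l => Cmul (idm j l) (f l)) = f j.
Proof.
  induction n as [|n IH]; intros Hj; [lia|]; simpl; unfold idm at 2.
  destruct (Nat.eqb_spec j n) as [->|Hjn].
  - rewrite (csum_ext n _ (fun _ => Cmul C0 C0)).
    2: { intros k Hk; unfold idm; destruct (Nat.eqb_spec n k); [lia | ring]. }
    rewrite csum_scale; ring.
  - rewrite IH by lia; ring.
Qed.

Lemma mpow_involution N c Z : mat_eq N N (mmul N Z Z) idm ->
  forall k, mat_eq N N (mpow N (mscale c Z) k) (mscale (cpow c k) (parity_part Z k)).
Proof.
  intros HZ; induction k as [|k IH]; intros i j Hi Hj; cbn [mpow cpow].
  - unfold mscale, parity_part; simpl; ring.
  - unfold mmul.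
    rewrite (csum_ext N _ (fun l => Cmul (Cmul (cpow c k) c) (Cmul (parity_part Z k i l) (Z l j)))).
    2: { intros l Hl; rewrite IH by assumption; unfold mscale; ring. }
    rewrite csum_scale; unfold mscale; f_equal.
    unfold parity_part; rewrite Nat.even_succ, <- Nat.negb_even.
    destruct (Nat.even k); simpl.
    + apply (csum_idm_l N (fun l => Z l j)); assumption.
    + apply HZ; assumption.
Qed.

(** Real and, next, imaginary part of the [k]-th term of the series of [exp (i phi)], padded by
    zeros so that one index runs through both. *)
Definition exp_even (phi : R) (k : nat) : R :=
  if Nat.even k then (-1) ^ (k / 2) * phi ^ k / INR (fact k) else 0.
Definition exp_odd (phi : R) (k : nat) : R :=
  if Nat.even k then 0 else (-1) ^ (k / 2) * phi ^ k / INR (fact k).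

Lemma cpow_i phi k :
  Cmul (RtoC (/ INR (fact k))) (cpow (Cmul Ci (RtoC phi)) k) =
  mkC (exp_even phi k) (exp_odd phi k).
Proof.
  assert (H : cpow (Cmul Ci (RtoC phi)) k =
    if Nat.even k then mkC ((-1) ^ (k / 2) * phi ^ k) 0
    else mkC 0 ((-1) ^ (k / 2) * phi ^ k)).
  { induction k as [|k IH].
    - simpl; unfold C1, RtoC; f_equal; ring.
    - cbn [cpow]; rewrite IH, Nat.even_succ, <- Nat.negb_even.
      destruct (Nat.even k) eqn:Ek; cbn [negb].
      + apply Nat.even_spec in Ek; destruct Ek as [q ->].
        replace (S (2 * q) / 2)%nat with q.
        2: { replace (S (2 * q)) with (1 + q * 2)%nat by lia.
             rewrite Nat.div_add by lia; reflexivity. }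
        replace (2 * q / 2)%nat with q by (rewrite Nat.mul_comm, Nat.div_mul; lia).
        unfold Cmul, Ci, RtoC; simpl; f_equal; ring.
      + rewrite <- Nat.negb_odd in Ek; apply Bool.negb_false_iff in Ek.
        apply Nat.odd_spec in Ek; destruct Ek as [q ->].
        replace ((2 * q + 1) / 2)%nat with q.
        2: { replace (2 * q + 1)%nat with (1 + q * 2)%nat by lia.
             rewrite Nat.div_add by lia; reflexivity. }
        replace (S (2 * q + 1) / 2)%nat with (S q).
        2: { replace (S (2 * q + 1)) with (S q * 2)%nat by lia.
             rewrite Nat.div_mul; lia. }
        unfold Cmul, Ci, RtoC; simpl; f_equal; ring. }
  rewrite H; unfold exp_even, exp_odd; destruct (Nat.even k);
    unfold Cmul, RtoC; simpl; f_equal; unfold Rdiv; ring.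
Qed.

(** The series behind [cos] skips the odd powers, so its partial sum at [k / 2] is compared with the
    padded one at [k]. *)
Lemma Un_cv_half_index u v l : Un_cv u l ->
  (forall k, v k = u (k / 2)%nat) -> Un_cv v l.
Proof.
  intros Hu Hv e He; destruct (Hu e He) as [n Hn]; exists (2 * n)%nat; intros k Hk.
  rewrite Hv; apply Hn; apply Nat.div_le_lower_bound; lia.
Qed.

Lemma exp_even_cv phi : Un_cv (sum_f_R0 (exp_even phi)) (cos phi).
Proof.
  unfold cos; destruct (exist_cos (Rsqr phi)) as [c Hc]; unfold cos_in in Hc.
  apply (Un_cv_half_index (sum_f_R0 (fun i => cos_n i * Rsqr phi ^ i)) _ _ Hc).
  assert (H : forall q,
    sum_f_R0 (exp_even phi) (2 * q) = sum_f_R0 (fun i => cos_n i * Rsqr phi ^ i) q /\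
    sum_f_R0 (exp_even phi) (S (2 * q)) = sum_f_R0 (fun i => cos_n i * Rsqr phi ^ i) q).
  { assert (T0 : forall q, exp_even phi (2 * q) = cos_n q * Rsqr phi ^ q).
    { intros q; unfold exp_even, cos_n.
      replace (Nat.even (2 * q)) with true by (symmetry; apply Nat.even_spec; exists q; lia).
      replace (2 * q / 2)%nat with q by (rewrite Nat.mul_comm, Nat.div_mul; lia).
      rewrite pow_mult; replace (phi ^ 2) with (Rsqr phi) by (unfold Rsqr; ring).
      unfold Rdiv; ring. }
    assert (T1 : forall q, exp_even phi (S (2 * q)) = 0).
    { intros q; unfold exp_even.
      rewrite Nat.even_succ, <- Nat.negb_even.
      replace (Nat.even (2 * q)) with true by (symmetry; apply Nat.even_spec; exists q; lia).
      reflexivity. }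
    induction q as [|q [_ IH]].
    - assert (E : sum_f_R0 (exp_even phi) (2 * 0) =
                  sum_f_R0 (fun i => cos_n i * Rsqr phi ^ i) 0) by exact (T0 0%nat).
      split; [exact E|]; rewrite tech5, E, (T1 0%nat); ring.
    - replace (2 * S q)%nat with (S (S (2 * q))) by lia.
      assert (E : sum_f_R0 (exp_even phi) (S (S (2 * q))) =
                  sum_f_R0 (fun i => cos_n i * Rsqr phi ^ i) (S q)).
      { rewrite tech5, IH, tech5; f_equal.
        replace (S (S (2 * q))) with (2 * S q)%nat by lia; apply T0. }
      split; [exact E|].
      rewrite tech5, E.
      replace (S (S (S (2 * q)))) with (S (2 * S q)) by lia.
      rewrite T1; ring. }
  intros k; destruct (Nat.Even_or_Odd k) as [[q ->]|[q ->]].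
  - destruct (H q) as [-> _]; f_equal; rewrite Nat.mul_comm, Nat.div_mul; lia.
  - replace (2 * q + 1)%nat with (S (2 * q)) by lia.
    destruct (H q) as [_ ->]; f_equal.
    replace (S (2 * q)) with (1 + q * 2)%nat by lia.
    rewrite Nat.div_add by lia; reflexivity.
Qed.

Lemma exp_odd_cv phi : Un_cv (sum_f_R0 (exp_odd phi)) (sin phi).
Proof.
  unfold sin; destruct (exist_sin (Rsqr phi)) as [c Hc]; unfold sin_in in Hc.
  assert (H : forall q,
    sum_f_R0 (exp_odd phi) (S (2 * q)) = phi * sum_f_R0 (fun i => sin_n i * Rsqr phi ^ i) q /\
    sum_f_R0 (exp_odd phi) (S (S (2 * q))) = phi * sum_f_R0 (fun i => sin_n i * Rsqr phi ^ i) q).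
  { assert (T0 : forall q, exp_odd phi (2 * q) = 0).
    { intros q; unfold exp_odd.
      replace (Nat.even (2 * q)) with true by (symmetry; apply Nat.even_spec; exists q; lia).
      reflexivity. }
    assert (T1 : forall q, exp_odd phi (S (2 * q)) = phi * (sin_n q * Rsqr phi ^ q)).
    { intros q; unfold exp_odd, sin_n.
      rewrite Nat.even_succ, <- Nat.negb_even.
      replace (Nat.even (2 * q)) with true by (symmetry; apply Nat.even_spec; exists q; lia).
      cbn [negb].
      replace (S (2 * q) / 2)%nat with q.
      2: { replace (S (2 * q)) with (1 + q * 2)%nat by lia.
           rewrite Nat.div_add by lia; reflexivity. }
      replace (2 * q + 1)%nat with (S (2 * q)) by lia.
      cbn [pow]; rewrite pow_mult; replace (phi ^ 2) with (Rsqr phi) by (unfold Rsqr; ring).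
      unfold Rdiv; ring. }
    induction q as [|q [_ IH]].
    - assert (E : sum_f_R0 (exp_odd phi) 1 = phi * sum_f_R0 (fun i => sin_n i * Rsqr phi ^ i) 0).
      { cbn [sum_f_R0]; rewrite (T1 0%nat : exp_odd phi 1 = _), (T0 0%nat : exp_odd phi 0 = _).
        ring. }
      split; [exact E|].
      change (2 * 0)%nat with 0%nat; rewrite tech5, E.
      change 2%nat with (2 * 1)%nat; rewrite T0; ring.
    - replace (2 * S q)%nat with (S (S (2 * q))) by lia.
      assert (E : sum_f_R0 (exp_odd phi) (S (S (S (2 * q)))) =
                  phi * sum_f_R0 (fun i => sin_n i * Rsqr phi ^ i) (S q)).
      { rewrite tech5, IH, (tech5 (fun i => sin_n i * Rsqr phi ^ i)).
        replace (S (S (S (2 * q)))) with (S (2 * S q)) by lia; rewrite T1; ring. }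
      split; [exact E|].
      rewrite tech5, E.
      replace (S (S (S (S (2 * q))))) with (2 * S (S q))%nat by lia.
      rewrite T0; ring. }
  assert (Hs : Un_cv (fun q => phi * sum_f_R0 (fun i => sin_n i * Rsqr phi ^ i) q) (phi * c)).
  { apply (CV_mult (fun _ => phi)); [|exact Hc].
    intros e He; exists 0%nat; intros; unfold Rdist; rewrite Rminus_diag, Rabs_R0; exact He. }
  (* The padded sine series starts with a zero term: its partial sum at [S k] is the sine sum at
     [k / 2]. The bound [2 * n + 1] accounts for this shift and excludes index 0. *)
  intros e He; destruct (Hs e He) as [n Hn]; exists (2 * n + 1)%nat; intros k Hk.
  destruct k as [|k]; [lia|].
  assert (E : sum_f_R0 (exp_odd phi) (S k) =
              phi * sum_f_R0 (fun i => sin_n i * Rsqr phi ^ i) (k / 2)).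
  { destruct (Nat.Even_or_Odd k) as [[q ->]|[q ->]].
    - destruct (H q) as [-> _]; do 2 f_equal; rewrite Nat.mul_comm, Nat.div_mul; lia.
    - replace (2 * q + 1)%nat with (S (2 * q)) by lia.
      destruct (H q) as [_ ->]; do 2 f_equal.
      replace (S (2 * q)) with (1 + q * 2)%nat by lia.
      rewrite Nat.div_add by lia; reflexivity. }
  rewrite E; apply Hn; apply Nat.div_le_lower_bound; lia.
Qed.

Lemma lim_C_unique u l :
  Un_cv (fun k => Re (u k)) (Re l) -> Un_cv (fun k => Im (u k)) (Im l) -> lim_C u = l.
Proof.
  intros Hr Hi; unfold lim_C.
  destruct (epsilon_spec (inhabits C0)
    (fun l => Un_cv (fun k => Re (u k)) (Re l) /\ Un_cv (fun k => Im (u k)) (Im l))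
    (ex_intro _ l (conj Hr Hi))) as [Hr' Hi'].
  match goal with |- ?e = _ => destruct e as [a b] end.
  destruct l as [c d]; simpl in *; f_equal; eapply UL_sequence; eassumption.
Qed.

Lemma Un_cv_combine u v a b x y : Un_cv u a -> Un_cv v b ->
  Un_cv (fun k => u k * x + v k * y) (a * x + b * y).
Proof.
  assert (Hk : forall z, Un_cv (fun _ => z) z).
  { intros z e He; exists 0%nat; intros; unfold Rdist; rewrite Rminus_diag, Rabs_R0; exact He. }
  intros Hu Hv; apply CV_plus; apply CV_mult; auto.
Qed.

(** Even powers of [Z] are the identity and odd ones are [Z], so the exponential series splits into
    a cosine and a sine series. *)
Lemma mexp_involution N phi Z i j : (i < N)%nat -> (j < N)%nat ->
  mat_eq N N (mmul N Z Z) idm ->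
  mexp N (mscale (Cmul Ci (RtoC phi)) Z) i j =
  Cadd (Cmul (RtoC (cos phi)) (idm i j)) (Cmul (mkC 0 (sin phi)) (Z i j)).
Proof.
  intros Hi Hj HZ; unfold mexp.
  assert (E : forall k, mexp_partial N (mscale (Cmul Ci (RtoC phi)) Z) k i j =
    Cadd (Cmul (RtoC (sum_f_R0 (exp_even phi) k)) (idm i j))
         (Cmul (mkC 0 (sum_f_R0 (exp_odd phi) k)) (Z i j))).
  { intros k; unfold mexp_partial, msum.
    assert (T : forall l, mscale (RtoC (/ INR (fact l)))
        (mpow N (mscale (Cmul Ci (RtoC phi)) Z) l) i j =
      Cadd (Cmul (RtoC (exp_even phi l)) (idm i j)) (Cmul (mkC 0 (exp_odd phi l)) (Z i j))).
    { intros l; unfold mscale at 1; rewrite mpow_involution by assumption.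
      unfold mscale.
      transitivity (Cmul (Cmul (RtoC (/ INR (fact l))) (cpow (Cmul Ci (RtoC phi)) l))
                         (parity_part Z l i j)); [ring|].
      rewrite cpow_i; unfold parity_part, exp_even, exp_odd; destruct (Nat.even l);
        unfold Cmul, Cadd, RtoC; simpl; f_equal; ring. }
    induction k as [|k IH].
    - cbn [csum sum_f_R0]; rewrite T; ring.
    - cbn [csum sum_f_R0] in *; rewrite IH, T.
      unfold Cmul, Cadd, RtoC; simpl; f_equal; ring. }
  pose proof (exp_even_cv phi) as Hc; pose proof (exp_odd_cv phi) as Hs.
  apply lim_C_unique.
  - eapply Un_cv_ext.
    2: { assert (X := Un_cv_combine _ _ _ _ (Re (idm i j)) (- Im (Z i j)) Hc Hs).
         replace (Re _) with (cos phi * Re (idm i j) + sin phi * - Im (Z i j));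
           [exact X | unfold Cmul, Cadd, RtoC; simpl; ring]. }
    intros k; rewrite E; unfold Cmul, Cadd, RtoC; simpl; ring.
  - eapply Un_cv_ext.
    2: { assert (X := Un_cv_combine _ _ _ _ (Im (idm i j)) (Re (Z i j)) Hc Hs).
         replace (Im _) with (cos phi * Im (idm i j) + sin phi * Re (Z i j));
           [exact X | unfold Cmul, Cadd, RtoC; simpl; ring]. }
    intros k; rewrite E; unfold Cmul, Cadd, RtoC; simpl; ring.
Qed.

Lemma unit_angle a b : a * a + b * b = 1 -> exists phi, cos phi = a /\ sin phi = b.
Proof.
  intros H; assert (Ha : -1 <= a <= 1) by nra.
  assert (Hs : sin (acos a) = Rabs b).
  { rewrite sin_acos by assumption; rewrite <- sqrt_Rsqr_abs; f_equal; unfold Rsqr; lra. }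
  destruct (Rle_dec 0 b) as [Hb|Hb].
  - exists (acos a); rewrite cos_acos, Hs by assumption.
    split; [reflexivity | apply Rabs_pos_eq; assumption].
  - exists (- acos a); rewrite cos_neg, sin_neg, cos_acos, Hs by assumption.
    split; [reflexivity | rewrite Rabs_left; lra].
Qed.

Module Amplification.
Import all_boot all_order all_algebra.
Import interval reals trigo polyrcf complex.
Import mathcomp.algebra_tactics.ring mathcomp.algebra_tactics.lra zify.
Set Implicit Arguments. Unset Strict Implicit. Unset Printing Implicit Defensive.
Import Order.TTheory GRing.Theory Num.Theory.
Local Open Scope ring_scope.

(** * Lukacs' theorem on the unit interval *)

(** Collects a size bound for every subexpression; [size_lia] then turns the sizes into arbitrary
    naturals and leaves pure arithmetic. *)
Ltac size_facts p :=
  lazymatch p with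
  | ?a + ?b => have := size_polyD a b; size_facts a; size_facts b
  | - ?a => rewrite ?(size_polyN a); size_facts a
  | ?a * ?b => have := size_polyMleq a b; size_facts a; size_facts b
  | polyC ?c => have := size_polyC_leq1 c
  | 1 => have := (size_poly1 _ : size p = 1%N)
  | polyX ?R => have := (size_polyX R : size p = 2%N)
  | _ => idtac
  end.
Ltac size_lia :=
  lazymatch goal with |- is_true (leq (size (polyseq ?p)) _) =>
    size_facts p;
    repeat match goal with H : is_true (leq (size _) _) |- _ => move: H end;
    repeat match goal with |- context [size (polyseq ?q)] =>
      move: (size (polyseq q)) => ? end; lia end.

Section Lukacs.
Variable R : rcfType.
Implicit Types (G H K a b c d : {poly R}) (n : nat).

(* The two shapes multiply as a [Z/2]-grading by the parity of [n], by
   two-squares identities; so only factors of degree 1 and 2 matter. *)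
Definition lukacs n G := if odd n then
    exists a b, [/\ (size a <= n./2.+1)%N, (size b <= n./2.+1)%N &
                    G = 'X * a ^+ 2 + (1 - 'X) * b ^+ 2]
  else exists a b, [/\ (size a <= n./2.+1)%N, (size b <= n./2)%N &
                    G = a ^+ 2 + 'X * (1 - 'X) * b ^+ 2].

Lemma lukacs_linear n G (p q : R) : 0 <= p -> 0 <= q ->
  lukacs n G -> lukacs n.+1 (G * ('X * p%:P + (1 - 'X) * q%:P)).
Proof.
move=> p0 q0; rewrite /lukacs.
have -> : p%:P = (Num.sqrt p)%:P ^+ 2 by rewrite -rmorphXn /= sqr_sqrtr.
have -> : q%:P = (Num.sqrt q)%:P ^+ 2 by rewrite -rmorphXn /= sqr_sqrtr.
move: (Num.sqrt p) (Num.sqrt q) => {p0 q0} {}p {}q.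
rewrite /= uphalf_half; case: ifP => on [a [b [sa sb ->]]] /=.
  exists ('X * a * p%:P + (1 - 'X) * b * q%:P), (a * q%:P - b * p%:P).
  split; last by ring.
    by size_lia.
  by size_lia.
exists (a * p%:P + (1 - 'X) * b * q%:P), (a * q%:P - 'X * b * p%:P).
split; last by ring.
  by size_lia.
by size_lia.
Qed.

Lemma lukacs_quadratic n G c (k : R) : (size c <= 2)%N -> 0 <= k ->
  lukacs n G -> lukacs n.+2 (G * (c ^+ 2 + 'X * (1 - 'X) * k%:P)).
Proof.
move=> sc k0; rewrite /lukacs.
have -> : k%:P = (Num.sqrt k)%:P ^+ 2 by rewrite -rmorphXn /= sqr_sqrtr.
move: (Num.sqrt k) => {k0} {}k.
rewrite /= negbK; case: ifP => on [a [b [sa sb ->]]] /=.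
  exists (a * c + (1 - 'X) * b * k%:P), (b * c - 'X * a * k%:P).
  by split; [size_lia | size_lia | ring].
exists (a * c - 'X * (1 - 'X) * b * k%:P), (a * k%:P + b * c).
by split; [size_lia | size_lia | ring].
Qed.

(** The linear factor with both constants equal to 1 is [X + (1 - X) = 1]. *)
Lemma lukacs_succ n G : lukacs n G -> lukacs n.+1 G.
Proof.
move=> /(lukacs_linear ler01 ler01); congr lukacs.
by rewrite polyC1; ring.
Qed.

(** A complex root [u + iv] exists. If [v] is nonzero, the remainder of [G] modulo [(X - u)^2 + v^2]
    is real of degree at most one and vanishes at a non-real point, hence is zero. *)
Lemma real_root_or_quadratic_factor G : (1 < size G)%N ->
  (exists r, root G r) \/
  exists u v : R, v != 0 /\ (('X - u%:P) ^+ 2 + (v ^+ 2)%:P) %| G.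
Proof.
move=> sG.
have [z rz] : exists z : R[i], root (map_poly (real_complex R) G) z.
  by apply/closed_rootP; rewrite size_map_poly neq_ltn sG orbT.
case: z rz => u v rz; have [v0|v0] := eqVneq v 0.
  left; exists u; move: rz; rewrite v0 /root => rz.
  have : (map_poly (real_complex R) G).[(real_complex R) u] == 0 by [].
  by rewrite horner_map fmorph_eq0.
right; exists u, v; split=> //.
set q := _ + _.
have sq : size q = 3%N.
  rewrite /q size_polyDl size_exp_XsubC // (leq_ltn_trans (size_polyC_leq1 _)) //.
have q0 : q != 0 by rewrite -size_poly_eq0 sq.
rewrite /dvdp; set r := G %% q.
have sr : (size r < 3)%N by rewrite -sq ltn_modp.
have rE : r = (r`_0)%:P + r`_1 *: 'X.
  apply/polyP => i; rewrite coefD coefC coefZ coefX.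
  case: i => [|[|i]] /=; rewrite ?mulr0 ?mulr1 ?addr0 ?add0r //.
  by rewrite nth_default // -ltnS (leq_trans sr).
have : (map_poly (real_complex R) (G %/ q * q + r)).[(u +i* v)%C] == 0.
  by rewrite -divp_eq.
rewrite rmorphD rmorphM /= hornerD hornerM.
have -> : (map_poly (real_complex R) q).[(u +i* v)%C] = 0.
  rewrite /q rmorphD rmorphXn rmorphB /= !map_polyC map_polyX !hornerE /= !expr2.
  by apply/eqP; rewrite eq_complex /=; apply/andP; split; apply/eqP; ring.
rewrite mulr0 add0r rE rmorphD /= map_polyC map_polyZ /= map_polyX !hornerE /=.
rewrite eq_complex /= => /andP[/eqP h1 /eqP h2].
have r1 : r`_1 = 0.
  move/eqP: h2; rewrite mul0r addr0 add0r mulf_eq0 (negPf v0) orbF. by move/eqP.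
by move: h1; rewrite r1 mul0r mul0r subr0 addr0 => ->; rewrite scale0r addr0.
Qed.


Lemma poly_ge0_limit G (r : R) : 0 < r < 1 ->
  (forall x, 0 < x < 1 -> x != r -> 0 <= G.[x]) -> 0 <= G.[r].
Proof.
move=> /andP[r0 r1] hG; rewrite leNgt; apply/negP => Gr.
have [d d0 hd] := @poly_cont _ r G (- G.[r]) (ltac:(by rewrite oppr_gt0)).
pose e := Num.min (d / 2) (r / 2).
have e0 : 0 < e by rewrite lt_min !divr_gt0.
have [ed er] : e <= d / 2 /\ e <= r / 2 by split; rewrite ge_min lexx ?orbT.
have : `|G.[r - e] - G.[r]| < - G.[r].
  by apply: hd; rewrite addrAC subrr add0r normrN gtr0_norm //; lra.
have : 0 <= G.[r - e] by apply: hG; [lra | apply/eqP; lra].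
by move=> h; rewrite ger0_norm; lra.
Qed.

(** At a simple root the cofactor would keep its sign while [x - r] changes sign, making [G]
    negative on one side. *)
Lemma interior_root_double G (r : R) : 0 < r < 1 ->
  (forall x, 0 < x < 1 -> 0 <= G.[x]) -> root G r ->
  exists2 H, G = H * ('X - r%:P) ^+ 2 & forall x, 0 < x < 1 -> 0 <= H.[x].
Proof.
move=> /andP[r0 r1] hG /factor_theorem[H GE].
have GHx x : G.[x] = H.[x] * (x - r) by rewrite GE !hornerE.
have [Hr|Hr] := eqVneq H.[r] 0.
  have /factor_theorem[K HE] : root H r by apply/eqP.
  exists K; first by rewrite GE HE -mulrA.
  have hK x : 0 < x < 1 -> x != r -> 0 <= K.[x].
    move=> x01 xr; have := hG _ x01; rewrite GHx HE !hornerE -mulrA -expr2.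
    by rewrite pmulr_lge0 // exprn_even_gt0 //= subr_eq0.
  move=> x x01; have [->|xr] := eqVneq x r; last exact: hK.
  by apply: poly_ge0_limit => //; rewrite r0.
have [d d0 hd] := @poly_cont _ r H `|H.[r]| (ltac:(by rewrite normr_gt0)).
pose e := Num.min (d / 2) (Num.min (r / 2) ((1 - r) / 2)).
have e0 : 0 < e by rewrite !lt_min !divr_gt0 // subr_gt0.
have [ed er er'] : [/\ e <= d / 2, e <= r / 2 & e <= (1 - r) / 2].
  by split; rewrite !ge_min lexx ?orbT.
have h1 : `|H.[r - e] - H.[r]| < `|H.[r]|.
  by apply: hd; rewrite addrAC subrr add0r normrN gtr0_norm //; lra.
have h2 : `|H.[r + e] - H.[r]| < `|H.[r]|.
  by apply: hd; rewrite addrAC subrr add0r gtr0_norm //; lra.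
have := hG (r - e) (ltac:(lra)); have := hG (r + e) (ltac:(lra)).
rewrite !GHx (addrAC r e) (addrAC r (- e)) subrr !add0r.
rewrite pmulr_lge0 // nmulr_lge0 ?oppr_lt0 // => k1 k2.
move: h1 h2; rewrite !ltr_norml.
by case: (ltrgtP H.[r] 0) Hr => // Hr _; [rewrite ltr0_norm | rewrite gtr0_norm] => //; lra.
Qed.

Lemma size_factor_leq H K n : (1 < size K)%N -> (size (H * K)%R <= n.+1)%N ->
  (size H <= n.+2 - size K)%N.
Proof.
move=> sK; have [->|H0] := eqVneq H 0; first by rewrite size_poly0.
have K0 : K != 0 by rewrite -size_poly_gt0; lia.
by rewrite size_mul //; move: (size H) (size K) sK; lia.
Qed.

(** Strong induction on [n], splitting off one real factor at a time: a conjugate pair or an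
    interior double root is quadratic and keeps the parity of [n]; a root outside the open interval
    is linear and flips it. *)
Theorem lukacs_nonneg n G : (size G <= n.+1)%N ->
  (forall x, 0 < x < 1 -> 0 <= G.[x]) -> lukacs n G.
Proof.
elim/ltn_ind: n G => n IH G sG hG.
have const (c : R) : 0 <= c -> forall k, lukacs k c%:P.
  move=> c0; elim=> [|k]; last exact: lukacs_succ.
  exists (Num.sqrt c)%:P, 0; split; rewrite ?size_poly0 ?size_polyC_leq1 //.
  by rewrite -rmorphXn /= sqr_sqrtr // expr0n mulr0 addr0.
have [s1|s1] := leqP (size G) 1.
  rewrite (size1_polyC s1) in hG *.
  by apply: const; have := hG (1 / 2) (ltac:(lra)); rewrite hornerC.
have G0 : G != 0 by rewrite -size_poly_gt0 ltnW.
have [[r rG]|[u [v [v0 /dvdpP[H GE]]]]] := real_root_or_quadratic_factor s1; last first.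
  have qpos x : 0 < (x - u) ^+ 2 + v ^+ 2.
    by rewrite ltr_wpDl ?sqr_ge0 // exprn_even_gt0.
  have sq : size (('X - u%:P) ^+ 2 + (v ^+ 2)%:P) = 3%N.
    by rewrite size_polyDl size_exp_XsubC // (leq_ltn_trans (size_polyC_leq1 _)).
  have {}IH : lukacs n.-2 H.
    have := sG; rewrite GE => /size_factor_leq; rewrite sq => /(_ isT) sH.
    apply: IH; [lia | lia | move=> x x01].
    by have := hG _ x01; rewrite GE !hornerE pmulr_lge0.
  (* The linear part is fixed by its values [p] at 0 and [- q] at 1; the opposite
     signs make its slope at least 1, which leaves a nonnegative multiple of
     [X (1 - X)]. *)
  pose p := Num.sqrt (u ^+ 2 + v ^+ 2).
  pose q := Num.sqrt ((1 - u) ^+ 2 + v ^+ 2).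
  have p2 : p ^+ 2 = u ^+ 2 + v ^+ 2 by rewrite sqr_sqrtr // addr_ge0 ?sqr_ge0.
  have q2 : q ^+ 2 = (1 - u) ^+ 2 + v ^+ 2.
    by rewrite sqr_sqrtr // addr_ge0 ?sqr_ge0.
  have pu : `|u| <= p.
    by rewrite -sqrtr_sqr ler_sqrt ?lerDl ?addr_ge0 ?sqr_ge0.
  have qu : `|1 - u| <= q.
    by rewrite -sqrtr_sqr ler_sqrt ?lerDl ?addr_ge0 ?sqr_ge0.
  have pq1 : 1 <= p + q.
    by move: pu qu; rewrite !ler_norml; lra.
  have n2 : (3 <= n.+1)%N by rewrite -sq (leq_trans _ sG) // dvdp_leq // GE dvdp_mulIr.
  have -> : n = n.-2.+2 by lia.
  have := @lukacs_quadratic n.-2 H (p%:P - (p + q)%:P * 'X) ((p + q) ^+ 2 - 1) _ _ IH.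
  have -> : (p%:P - (p + q)%:P * 'X) ^+ 2 + 'X * (1 - 'X) * ((p + q) ^+ 2 - 1)%:P
     = ('X - u%:P) ^+ 2 + (v ^+ 2)%:P.
    transitivity ((p ^+ 2)%:P + 'X * (q ^+ 2 - p ^+ 2 - 1)%:P + 'X ^+ 2).
      by rewrite !(rmorphB, rmorphD, rmorphXn) rmorph1 /=; ring.
    by rewrite p2 q2 !(rmorphB, rmorphD, rmorphXn) rmorph1 /=; ring.
  by rewrite -GE; apply; [size_lia | rewrite subr_ge0 exprn_ege1].
have [r0|r0] := leP r 0.
  have /factor_theorem[H GE] := rG.
  have {}IH : lukacs n.-1 H.
    have := sG; rewrite GE => /size_factor_leq; rewrite size_XsubC => /(_ isT) sH.
    apply: IH; [lia | lia | move=> x x01].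
    by have := hG _ x01; rewrite GE !hornerE pmulr_lge0 //; lra.
  have := lukacs_linear (_ : 0 <= 1 - r) (_ : 0 <= - r) IH.
  have -> : 'X * (1 - r)%:P + (1 - 'X) * (- r)%:P = 'X - r%:P.
    by rewrite !rmorphB !rmorphN rmorph1 /=; ring.
  by rewrite -GE prednK; [apply; lra | lia].
have [r1|r1] := leP 1 r.
  (* For [r >= 1] the factor [X - r] is negative on the interval, so the sign moves to the cofactor,
     and [r - X] has the nonnegative coefficients [r - 1] and [r]. *)
  have /factor_theorem[H GE] := rG.
  have {}IH : lukacs n.-1 (- H).
    have := sG; rewrite GE => /size_factor_leq; rewrite size_XsubC => /(_ isT) sH.
    apply: IH; [lia | rewrite size_polyN; move: (size H) sH; lia | move=> x x01].
    by have := hG _ x01; rewrite GE !hornerE nmulr_lge0 ?oppr_ge0 //; lra.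
  have := lukacs_linear (_ : 0 <= r - 1) (_ : 0 <= r) IH.
  have -> : - H * ('X * (r - 1)%:P + (1 - 'X) * r%:P) = H * ('X - r%:P).
    by rewrite !rmorphB rmorph1 /=; ring.
  by rewrite -GE prednK; [apply; lra | lia].
have r01 : 0 < r < 1 by rewrite r0.
have [H GE hH] := interior_root_double r01 hG rG.
have {}IH : lukacs n.-2 H.
  have := sG; rewrite GE => /size_factor_leq; rewrite size_exp_XsubC => /(_ isT) sH.
  by apply: IH; [lia | lia |].
have n2 : (3 <= n.+1)%N.
  by rewrite -(size_exp_XsubC 2 r) (leq_trans _ sG) // dvdp_leq // GE dvdp_mulIr.
have -> : n = n.-2.+2 by lia.
have := @lukacs_quadratic n.-2 H ('X - r%:P) 0 _ (lexx _) IH.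
by rewrite polyC0 mulr0 addr0 -GE; apply; rewrite size_XsubC.
Qed.

End Lukacs.

(** * A polynomial step function *)

Section Kernel.
Variable R : realType.
Implicit Types (a : nat -> R) (t phi psi : R).

(** Chebyshev polynomials of the first kind, carried in consecutive pairs to make the recurrence
    structural. *)
Fixpoint chebyshev2 n : {poly R} * {poly R} :=
  if n is n'.+1 then let: (p, q) := chebyshev2 n' in (q, 2%:P * 'X * q - p)
  else (1, 'X).
Definition chebyshev n := (chebyshev2 n).1.

Lemma chebyshev2E n : chebyshev2 n = (chebyshev n, chebyshev n.+1).
Proof. by rewrite /chebyshev /=; case: chebyshev2. Qed.

Lemma chebyshevSS n :
  chebyshev n.+2 = 2%:P * 'X * chebyshev n.+1 - chebyshev n.
Proof. by rewrite {1}/chebyshev /= chebyshev2E. Qed.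

Lemma size_chebyshev n : (size (chebyshev n) <= n.+1)%N.
Proof.
suff: (size (chebyshev n) <= n.+1)%N /\ (size (chebyshev n.+1) <= n.+2)%N by case.
elim: n => [|n [IH1 IH2]]; first by rewrite /chebyshev /= size_poly1 size_polyX.
by split=> //; rewrite chebyshevSS; size_lia.
Qed.

Lemma chebyshev_cos n t : (chebyshev n).[cos t] = cos (n%:R * t).
Proof.
suff: (chebyshev n).[cos t] = cos (n%:R * t) /\
      (chebyshev n.+1).[cos t] = cos (n.+1%:R * t) by case.
elim: n => [|n [IH1 IH2]].
  by rewrite /chebyshev /= !hornerE ?mul0r ?mul1r cos0.
split=> //; rewrite chebyshevSS !hornerE IH1 IH2.
have -> : n.+2%:R * t = n.+1%:R * t + t by rewrite -natr1; ring.
have -> : n%:R * t = n.+1%:R * t - t by rewrite -natr1; ring.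
by rewrite cosB cosD; ring.
Qed.

Definition trig_cos a n t := \sum_(l < n) a l * cos (l%:R * t).
Definition trig_sin a n t := \sum_(l < n) a l * sin (l%:R * t).
(** The squared modulus of [sum_l a_l e^(ilt)]: a nonnegative kernel with frequencies below [n]. *)
Definition fejer a n t := trig_cos a n t ^+ 2 + trig_sin a n t ^+ 2.

Lemma fejer_ge0 a n t : 0 <= fejer a n t.
Proof. by rewrite addr_ge0 ?sqr_ge0. Qed.

Lemma fejerE a n t :
  fejer a n t = \sum_(l < n) \sum_(k < n) a l * a k * cos ((l%:R - k%:R) * t).
Proof.
rewrite /fejer !expr2 /trig_cos /trig_sin !mulr_suml -big_split /=.
apply: eq_bigr => l _; rewrite !mulr_sumr -big_split /=.
by apply: eq_bigr => k _; rewrite mulrBl cosB; ring.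
Qed.

Lemma fejerN a n t : fejer a n (- t) = fejer a n t.
Proof.
by rewrite !fejerE; apply: eq_bigr => l _; apply: eq_bigr => k _; rewrite mulrN cosN.
Qed.

(** Multiplication by [sin h], nonzero for [h = pi j / M] because [0 < j < M], makes the sum
    telescope, and the angles at its two ends differ by [j] full periods. *)
Lemma grid_sum_cos M j t : (0 < j < M)%N ->
  \sum_(k < M) cos (j%:R * (t - 2 * (pi * k%:R / M%:R))) = 0.
Proof.
move=> /andP[j0 jM].
have M0 : (M%:R : R) != 0 by rewrite pnatr_eq0; lia.
pose h : R := pi * j%:R / M%:R.
pose F (k : nat) : R := sin (j%:R * t + h - 2 * h * k%:R).
have sh : sin h != 0.
  rewrite gt_eqF // sin_gt0_pi // divr_gt0 ?mulr_gt0 ?pi_gt0 ?ltr0n //=; last lia.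
  by rewrite ltr_pdivrMr ?ltr_pM2l ?pi_gt0 ?ltr_nat ?ltr0n //; lia.
apply: (mulfI sh); rewrite mulr0 mulr_sumr.
transitivity (\sum_(k < M) - ((F k.+1 - F k) / 2)).
  apply: eq_bigr => k _; rewrite /F.
  have -> : j%:R * t + h - 2 * h * k.+1%:R = j%:R * (t - 2 * (pi * k%:R / M%:R)) - h.
    by rewrite -natr1 /h; field.
  have -> : j%:R * t + h - 2 * h * k%:R = j%:R * (t - 2 * (pi * k%:R / M%:R)) + h.
    by rewrite /h; field.
  by rewrite sinB sinD; field.
rewrite sumrN -mulr_suml -(big_mkord xpredT (fun k => F k.+1 - F k)) telescope_sumr //.
rewrite /F mulr0 subr0.
have zE : j%:R * t + h - 2 * h * M%:R + (pi *+ 2) *+ j = j%:R * t + h.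
  by rewrite /h -mulr_natr -[pi *+ 2]mulr_natr; field.
by rewrite -[in X in _ - X]zE (periodicn (@sinD2pi R)) subrr mul0r oppr0.
Qed.

(** The frequency differences [l - k] are smaller than [n <= M] in absolute value, so all but the
    diagonal terms cancel over the grid. *)
Lemma grid_parseval M a n t : (0 < n <= M)%N ->
  \sum_(k < M) fejer a n (t - 2 * (pi * k%:R / M%:R)) = M%:R * \sum_(l < n) a l ^+ 2.
Proof.
move=> /andP[n0 nM]; under eq_bigr do rewrite fejerE.
rewrite exchange_big mulr_sumr /=; apply: eq_bigr => l _.
rewrite exchange_big (bigD1 l) //= [X in _ + X]big1 ?addr0.
  under eq_bigr do rewrite subrr mul0r cos0 mulr1.
  by rewrite sumr_const card_ord mulr_natl expr2.
move=> k kl; rewrite -mulr_sumr.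
have kl' : (k != l :> nat) by [].
have [lk|lk] := leqP l k.
  under eq_bigr => i _ do rewrite -cosN -mulNr opprB -natrB //.
  by rewrite grid_sum_cos ?mulr0 //; have := ltn_ord k; lia.
under eq_bigr => i _ do rewrite -natrB 1?ltnW //.
by rewrite grid_sum_cos ?mulr0 //; have := ltn_ord l; lia.
Qed.

(* Coefficients vanishing at [l = -1] and [l = n]: multiplying the kernel by
   [4 sin^2] differences them, and the ratio of the two sums of squares is
   [10 / ((n + 1)^2 + 1)]. *)
Definition parab (n l : nat) : R := (l%:R + 1) * (n%:R - l%:R).
Definition dparab (n l : nat) : R := n%:R - 2 * l%:R.

Lemma sum_parab n : \sum_(l < n) parab n l ^+ 2 =
  n%:R * (n%:R + 1) * (n%:R + 2) * ((n%:R + 1) ^+ 2 + 1) / 30.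
Proof.
(* The upper limit [k] is separated from the parameter [y] to allow induction. [S1], [S2], [S4] are
   sums of first, second and fourth powers; the sum of cubes is [S1 ^+ 2]. *)
suff E (k : nat) (y : R) : \sum_(l < k) ((l%:R + 1) * (y - l%:R)) ^+ 2 =
  let K : R := k%:R in let S1 := K * (K - 1) / 2 in
  let S2 := K * (K - 1) * (2 * K - 1) / 6 in
  let S4 := K * (K - 1) * (2 * K - 1) * (3 * K ^+ 2 - 3 * K - 1) / 30 in
  y ^+ 2 * (S2 + 2 * S1 + K) - 2 * y * (S1 ^+ 2 + 2 * S2 + S1)
  + (S4 + 2 * S1 ^+ 2 + S2).
  by rewrite /parab E /=; field.
elim: k => [|k IH]; first by rewrite big_ord0 /=; field.
by rewrite big_ord_recr /= IH /= -natr1; field.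
Qed.

Lemma sum_dparab n : \sum_(l < n.+1) dparab n l ^+ 2 =
  n%:R * (n%:R + 1) * (n%:R + 2) / 3.
Proof.
suff E (k : nat) (y : R) : \sum_(l < k) (y - 2 * l%:R) ^+ 2 =
  let K : R := k%:R in
  K * y ^+ 2 - 2 * y * K * (K - 1) + 2 * K * (K - 1) * (2 * K - 1) / 3.
  by rewrite /dparab E /= -natr1; field.
elim: k => [|k IH]; first by rewrite big_ord0 /=; field.
by rewrite big_ord_recr /= IH /= -natr1; field.
Qed.

(** [2 (1 - cos t)] is [|1 - e^(it)|^2], and multiplication by [1 - e^(it)] takes successive
    differences of the coefficients. Since [parab] vanishes at both ends, these are [dparab] on the
    whole range [l <= n]. *)
Lemma fejer_diff n t :
  2 * (1 - cos t) * fejer (parab n) n t = fejer (dparab n) n.+1 t.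
Proof.
pose c := trig_cos (parab n) n t; pose s := trig_sin (parab n) n t.
have top : parab n n = 0 by rewrite /parab subrr mulr0.
have dE (l : nat) : dparab n l = parab n l - l%:R * (n%:R + 1 - l%:R).
  by rewrite /dparab /parab; ring.
have shiftE (F : nat -> R) :
    \sum_(l < n.+1) dparab n l * F l = \sum_(l < n) parab n l * F l
      - \sum_(l < n) parab n l * F l.+1.
  under eq_bigr => l _ do rewrite dE mulrBl.
  rewrite sumrB big_ord_recr /= top mul0r addr0; congr (_ - _).
  rewrite big_ord_recl /= !mul0r add0r; apply: eq_bigr => l _.
  by rewrite /parab /bump /= add1n -natr1; ring.
have hc : trig_cos (dparab n) n.+1 t = c - (c * cos t - s * sin t).
  rewrite /trig_cos (shiftE (fun l => cos (l%:R * t))); congr (_ - _).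
  rewrite /c /s /trig_cos /trig_sin !mulr_suml -sumrB; apply: eq_bigr => l _.
  by rewrite -natr1 mulrDl mul1r cosD; ring.
have hs : trig_sin (dparab n) n.+1 t = s - (s * cos t + c * sin t).
  rewrite /trig_sin (shiftE (fun l => sin (l%:R * t))); congr (_ - _).
  rewrite /c /s /trig_cos /trig_sin !mulr_suml -big_split; apply: eq_bigr => l _.
  by rewrite -natr1 mulrDl mul1r sinD /=; ring.
rewrite /fejer hc hs -/c -/s.
have cs := cos2Dsin2 t.
transitivity ((c ^+ 2 + s ^+ 2) * ((1 - cos t) ^+ 2 + sin t ^+ 2)); last by ring.
rewrite (_ : sin t ^+ 2 = 1 - cos t ^+ 2); first by ring.
by rewrite -cs; ring.
Qed.

End Kernel.

Section StepPolynomial.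
Variable R : realType.
Implicit Types (t phi psi : R) (n k : nat).

Definition node n k : R := pi * k%:R / n.+1%:R.
(** The nodes cover half a turn and the kernel doubles the angle, since the square of [sin] has
    period [pi]. The denominator is the total from [grid_parseval], so the weights form a
    probability distribution. *)
Definition weight n phi k : R :=
  fejer (parab R n) n (2 * (phi - node n k)) /
  (n.+1%:R * \sum_(l < n) parab R n l ^+ 2).

Lemma sum_parab_gt0 n : (0 < n)%N -> 0 < \sum_(l < n) parab R n l ^+ 2.
Proof.
move=> n0; rewrite sum_parab.
have : 0 < (n%:R : R) by rewrite ltr0n.
move: (n%:R : R) => x x0; rewrite divr_gt0 // !mulr_gt0 //; first lra.
  lra.
by rewrite ltr_wpDl // sqr_ge0.
Qed.

Lemma weight_ge0 n phi k : (0 < n)%N -> 0 <= weight n phi k.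
Proof.
move=> n0; rewrite divr_ge0 ?fejer_ge0 // mulr_ge0 // ltW // sum_parab_gt0 //.
Qed.

Lemma sum_weight n phi : (0 < n)%N -> \sum_(k < n.+1) weight n phi k = 1.
Proof.
move=> n0; rewrite -mulr_suml.
under eq_bigr do rewrite mulrBr.
rewrite grid_parseval ?n0 ?leqnSn // divff // mulf_neq0 ?pnatr_eq0 //.
by rewrite gt_eqF // sum_parab_gt0.
Qed.

Lemma cos_double t : cos (2 * t) = 1 - 2 * sin t ^+ 2.
Proof. by rewrite mulr_natl cos_mulr2n cos2sin2 -mulr_natr; ring. Qed.

(** This is the variance of the weights: by [fejer_diff] the squared sine turns the [parab] kernel
    into the [dparab] kernel, and [n + 1] nodes are just enough for [grid_parseval] to sum the
    latter. *)
Lemma sum_weight_sin n phi : (0 < n)%N ->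
  \sum_(k < n.+1) weight n phi k * sin (phi - node n k) ^+ 2
  <= 5 / (2 * n%:R ^+ 2).
Proof.
move=> n0.
have S0 := sum_parab_gt0 n0.
have -> : \sum_(k < n.+1) weight n phi k * sin (phi - node n k) ^+ 2 =
   (\sum_(l < n.+1) dparab R n l ^+ 2) / (4 * \sum_(l < n) parab R n l ^+ 2).
  have N0 : (n.+1%:R : R) != 0 by rewrite pnatr_eq0.
  apply: (mulfI N0); rewrite [RHS]mulrA -(@grid_parseval R n.+1 _ n.+1 (2 * phi)) ?leqnn //.
  rewrite mulr_sumr mulr_suml; apply: eq_bigr => k _.
  rewrite -fejer_diff -/(node n k) -mulrBr /weight.
  set t := phi - _; rewrite cos_double.
  move: (n.+1%:R : R) (\sum_(l < n) _) (fejer _ _ _) N0 S0 => x z w x0 z0.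
  by field; rewrite x0 gt_eqF.
rewrite sum_parab sum_dparab.
have : 0 < (n%:R : R) by rewrite ltr0n.
move: (n%:R : R) => x x0.
have h : 0 < (x + 1) ^+ 2 + 1 by rewrite ltr_wpDl // sqr_ge0.
have -> : x * (x + 1) * (x + 2) / 3 / (4 * (x * (x + 1) * (x + 2) * ((x + 1) ^+ 2 + 1) / 30))
   = 5 / (2 * ((x + 1) ^+ 2 + 1)).
  move: ((x + 1) ^+ 2 + 1) h => z z0.
  have [x1 x2] : 0 < x + 1 /\ 0 < x + 2 by split; lra.
  by field; rewrite !gt_eqF.
rewrite ler_pM2l // lef_pV2 ?posrE ?mulr_gt0 ?exprn_gt0 // ler_pM2l //.
by rewrite !expr2; nra.
Qed.

(** Chebyshev's inequality, with [sum_weight_sin] as the variance bound. *)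
Lemma far_weight n phi (eta : R) (P : pred nat) : (0 < n)%N -> 0 < eta ->
  (forall k, P k -> eta <= `|sin (phi - node n k)|) ->
  \sum_(k < n.+1 | P k) weight n phi k <= 5 / (2 * n%:R ^+ 2) / eta ^+ 2.
Proof.
move=> n0 e0 hP; rewrite ler_pdivlMr ?exprn_gt0 //.
apply: le_trans (sum_weight_sin phi n0); rewrite mulr_suml [leRHS](bigID (fun k : 'I__ => P k)) /=.
rewrite -[leLHS]addr0 lerD //.
  apply: ler_sum => k /hP h; rewrite ler_wpM2l ?weight_ge0 //.
  by rewrite -[leRHS]real_normK ?num_real // lerXn2r ?nnegrE ?(ltW e0).
by apply: sumr_ge0 => k _; rewrite mulr_ge0 ?weight_ge0 ?sqr_ge0.
Qed.

Lemma norm_sin_triangle phi psi : `|sin psi| <= `|sin phi| + `|sin (phi - psi)|.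
Proof.
have -> : psi = phi - (phi - psi) by ring.
move: (phi - psi) => t; rewrite subKr sinB (le_trans (ler_normB _ _)) //.
by rewrite !normrM lerD // ?ler_piMr ?ler_piMl ?cos_max.
Qed.

(** The weight of the selected nodes, averaged over [phi] and [- phi] and written in
    [X = sin phi ^ 2]: [cos (2 (l - j) phi)] is a Chebyshev polynomial in [cos (2 phi) = 1 - 2 X].
    With truncated subtraction, [(l - j) + (j - l)] is [|l - j|]. *)
Definition step_poly n (c : pred nat) : {poly R} :=
  \sum_(k < n.+1 | c k) \sum_(l < n) \sum_(j < n)
    (parab R n l * parab R n j * cos ((l%:R - j%:R) * (2 * node n k)) /
      (n.+1%:R * \sum_(i < n) parab R n i ^+ 2)) *:
    (chebyshev R ((l - j) + (j - l)) \Po (1 - 2%:P * 'X)).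

Lemma size_step_poly n c : (size (step_poly n c) <= n)%N.
Proof.
apply: (leq_trans (size_sum _ _ _)); apply/bigmax_leqP => k _.
apply: (leq_trans (size_sum _ _ _)); apply/bigmax_leqP => l _.
apply: (leq_trans (size_sum _ _ _)); apply/bigmax_leqP => j _.
apply: (leq_trans (size_scale_leq _ _)).
apply: (leq_trans (size_comp_poly_leq _ _)).
have s2 : (size (1 - 2%:P * 'X : {poly R})%R <= 2)%N by size_lia.
have := size_chebyshev R ((l - j) + (j - l)).
have := ltn_ord l; have := ltn_ord j.
move: (size _) (size (polyseq (1 - _)%R)) s2 => x y; nia.
Qed.

Lemma step_polyE n c phi : (step_poly n c).[sin phi ^+ 2] =
  \sum_(k < n.+1 | c k) (weight n phi k + weight n (- phi) k) / 2.
Proof.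
rewrite /step_poly horner_sum; apply: eq_bigr => k _.
rewrite /weight; set N := _ * \sum_(i < n) _.
rewrite (_ : 2 * (- phi - _) = - (2 * phi + 2 * node n k)); last by ring.
rewrite fejerN -mulrDl !fejerE horner_sum -big_split /= !mulr_suml.
apply: eq_bigr => l _; rewrite horner_sum -big_split /= !mulr_suml.
apply: eq_bigr => j _; rewrite hornerZ horner_comp.
have -> : (1 - 2%:P * 'X : {poly R}).[sin phi ^+ 2] = cos (2 * phi).
  by rewrite cos_double !hornerE.
rewrite chebyshev_cos.
have -> : cos ((l - j + (j - l))%:R * (2 * phi)) = cos ((l%:R - j%:R) * (2 * phi)).
  have [lj|lj] := leqP l j.
    by rewrite (eqP (lj : l - j == 0)%N) add0n natrB // -[RHS]cosN -mulNr opprB.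
  by rewrite (eqP (ltnW lj : j - l == 0)%N) addn0 natrB // ltnW.
(* Averaging over [phi] and [- phi] cancels the product of sines and leaves that of cosines. *)
move: (l%:R - j%:R) (N^-1) => e M; rewrite (mulrBr 2) (mulrBr e) cosB (mulrDr e) cosD; by field.
Qed.

(** The selected nodes have [|sin|] at most the midpoint of [a] and [b]. For an angle with [|sin|]
    at most [a] or at least [b], the sine of its difference to any node on the wrong side is at
    least [(b - a) / 2] in absolute value, so [far_weight] bounds the misplaced weight. *)
Theorem step_polynomial n (a b : R) : 0 <= a -> 6 <= n%:R * (b - a) ->
  exists q : {poly R}, [/\ (size q <= n)%N,
    forall y, 0 <= y <= 1 -> 0 <= q.[y] <= 1,
    forall y, 0 <= y <= 1 -> y <= a ^+ 2 -> 2 / 3 <= q.[y] &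
    forall y, 0 <= y <= 1 -> 0 <= b -> b ^+ 2 <= y -> q.[y] <= 1 / 3].
Proof.
move=> a0 nab.
have n0 : (0 < n)%N by case: n nab => //; rewrite mul0r; lra.
have nR : 1 <= (n%:R : R) by rewrite ler1n.
have ab : 0 < b - a by rewrite -(pmulr_rgt0 _ (lt_le_trans ltr01 nR)); lra.
pose c := [pred k : nat | `|sin (node n k)| <= (a + b) / 2].
have sinE (y : R) : 0 <= y <= 1 -> exists2 phi, sin phi ^+ 2 = y & `|sin phi| = Num.sqrt y.
  move=> /andP[y0 y1]; have s1 : Num.sqrt y <= 1 by rewrite -sqrtr1 ler_sqrt.
  exists (asin (Num.sqrt y)); rewrite asinK ?in_itv /= ?s1 ?andbT ?sqr_sqrtr //.
  - by rewrite (le_trans _ (sqrtr_ge0 _)) // lerN10.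
  - by rewrite ger0_norm ?sqrtr_ge0.
  - by rewrite (le_trans _ (sqrtr_ge0 _)) // lerN10.
(* The variance bound over the squared half gap is [10 / (n (b - a))^2], at most [10 / 36] by
   hypothesis. *)
have small : 5 / (2 * n%:R ^+ 2) / ((b - a) / 2) ^+ 2 <= 1 / 3 :> R.
  have -> : 5 / (2 * n%:R ^+ 2) / ((b - a) / 2) ^+ 2 = 10 / (n%:R * (b - a)) ^+ 2 :> R.
    by field; rewrite gt_eqF //= gt_eqF //; lra.
  rewrite ler_pdivrMr; last by rewrite exprn_gt0 //; lra.
  have : 6 ^+ 2 <= (n%:R * (b - a)) ^+ 2 :> R by rewrite lerXn2r ?nnegrE //; lra.
  lra.
have e0 : 0 < (b - a) / 2 by lra.
have half_sum (Q : pred nat) phi (r : R) : \sum_(k < n.+1 | Q k) weight n phi k <= r ->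
   \sum_(k < n.+1 | Q k) weight n (- phi) k <= r ->
   \sum_(k < n.+1 | Q k) (weight n phi k + weight n (- phi) k) / 2 <= r.
  by move=> h1 h2; rewrite -mulr_suml big_split ler_pdivrMr // mulr_natr mulr2n lerD.
have total phi : \sum_(k < n.+1 | c k) (weight n phi k + weight n (- phi) k) / 2 =
   1 - \sum_(k < n.+1 | ~~ c k) (weight n phi k + weight n (- phi) k) / 2.
  have tot psi : \sum_(k < n.+1 | c k) weight n psi k =
      1 - \sum_(k < n.+1 | ~~ c k) weight n psi k.
    by rewrite -(sum_weight psi n0) (bigID (fun k : 'I__ => c k) predT) /= addrK.
  by rewrite -!mulr_suml !big_split /= !tot; field.
have pos (Q : pred nat) phi : 0 <= \sum_(k < n.+1 | Q k) (weight n phi k + weight n (- phi) k) / 2.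
  by apply: sumr_ge0 => k _; rewrite divr_ge0 ?addr_ge0 ?weight_ge0.
exists (step_poly n c); split.
- exact: size_step_poly.
- move=> y /sinE[phi <- _]; rewrite step_polyE pos total lerBlDr lerDl.
  exact: (pos [pred k | ~~ c k]).
- move=> y /sinE[phi yE phiE] ya; rewrite -yE step_polyE total.
  have sa : `|sin phi| <= a by rewrite phiE -(ger0_norm a0) -sqrtr_sqr ler_sqrt ?sqr_ge0.
  have far psi : `|sin psi| <= a -> forall k, ~~ c k -> (b - a) / 2 <= `|sin (psi - node n k)|.
    by move=> h k; rewrite /c /= -ltNge; have := norm_sin_triangle psi (node n k); lra.
  have h : forall k, ~~ c k -> (b - a) / 2 <= `|sin (- phi - node n k)|.
    by apply: far; rewrite sinN normrN.
  apply: (@le_trans _ _ (1 - 1 / 3)); first by lra.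
  rewrite lerD2l lerN2; apply: le_trans small; apply: (half_sum [pred k | ~~ c k]).
    by apply: (@far_weight n phi _ [pred k | ~~ c k]) => //; exact: far.
  exact: (@far_weight n (- phi) _ [pred k | ~~ c k]).
move=> y /sinE[phi yE phiE] b0 yb; rewrite -yE step_polyE.
have sb : b <= `|sin phi|.
  by rewrite phiE -(ger0_norm b0) -sqrtr_sqr ler_sqrt // (le_trans _ yb) ?sqr_ge0.
have far psi : b <= `|sin psi| -> forall k, c k -> (b - a) / 2 <= `|sin (psi - node n k)|.
  move=> h k; rewrite /c /=; have := norm_sin_triangle (node n k) psi.
  by rewrite -opprB sinN normrN; lra.
have h : forall k, c k -> (b - a) / 2 <= `|sin (- phi - node n k)|.
  by apply: far; rewrite sinN normrN.
apply: le_trans small; apply: half_sum; apply: far_weight => //; exact: far.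
Qed.

End StepPolynomial.

(** * Majority polynomials *)

Section Majority.
Variable R : realFieldType.
Implicit Types (y : R) (r k : nat).

Definition binom_term r k y : R := (y ^+ k * (1 - y) ^+ (r - k)) *+ 'C(r, k).

(** At [y], the probability that more than half of [2 r + 1] independent votes succeed, each with
    probability [y]. *)
Definition majority r : {poly R} :=
  \sum_(k < r.*2.+2 | (r < k)%N) ('X ^+ k * (1 - 'X) ^+ (r.*2.+1 - k)) *+ 'C(r.*2.+1, k).

Lemma size_majority r : (size (majority r) <= r.*2.+2)%N.
Proof.
apply: (leq_trans (size_sum _ _ _)); apply/bigmax_leqP => k _.
rewrite -scaler_nat (leq_trans (size_scale_leq _ _)) //.
apply: (leq_trans (size_polyMleq _ _)); rewrite size_polyXn /=.
have s1 : (size (1 - 'X : {poly R})%R <= 2)%N by size_lia.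
have := size_poly_exp_leq (1 - 'X : {poly R}) (r.*2.+1 - k).
have := ltn_ord k; move: (size _) (size (polyseq (1 - 'X)%R)) s1 => x z; nia.
Qed.

Lemma majorityE r y :
  (majority r).[y] = \sum_(k < r.*2.+2 | (r < k)%N) binom_term r.*2.+1 k y.
Proof.
rewrite /majority horner_sum; apply: eq_bigr => k _.
by rewrite hornerMn hornerM !horner_exp !hornerE.
Qed.

Lemma binom_term_ge0 r k y : 0 <= y <= 1 -> 0 <= binom_term r k y.
Proof.
by move=> /andP[y0 y1]; rewrite mulrn_wge0 // mulr_ge0 ?exprn_ge0 ?subr_ge0.
Qed.

Lemma sum_binom_term r y : \sum_(k < r.+1) binom_term r k y = 1.
Proof.
have := exprDn (1 - y) y r; rewrite subrK expr1n => ->.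
by apply: eq_bigr => k _; rewrite /binom_term mulrC.
Qed.

(** Exchanging success and failure maps [k] to [2 r + 1 - k], and an odd number of votes leaves no
    tie. *)
Lemma majority_compl r y : (majority r).[1 - y] = 1 - (majority r).[y].
Proof.
rewrite !majorityE -[X in _ = X - _](sum_binom_term r.*2.+1 y).
rewrite [in RHS](bigID (fun k : 'I__ => (r < k)%N)) /=.
rewrite addrAC subrr add0r (reindex_inj rev_ord_inj) /=; apply: eq_big => [k|k _].
  by have := ltn_ord k; lia.
rewrite /binom_term subKr; have := ltn_ord k => kr.
have -> : (r.*2.+2 - k.+1 = r.*2.+1 - k)%N by lia.
by rewrite subKn 1?mulrC ?bin_sub //; lia.
Qed.

(** For [k > r], replacing one factor [y] by 1 and the other surplus ones by [1 - y] bounds the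
    product by [(y (1 - y))^r]. The binomial coefficients add up to [2 * 4^r], and
    [4 y (1 - y) <= 8 / 9] when [y <= 1 / 3]. *)
Lemma majority_le r y : 0 <= y <= 1 / 3 -> (majority r).[y] <= 2 * (8 / 9) ^+ r.
Proof.
move=> /andP[y0 y13]; rewrite majorityE.
have y1 : 0 <= 1 - y by lra.
have term k : (r < k < r.*2.+2)%N ->
    binom_term r.*2.+1 k y <= (y * (1 - y)) ^+ r *+ 'C(r.*2.+1, k).
  move=> /andP[rk kr]; rewrite lerMn2r; apply/orP; right.
  have -> : y ^+ k * (1 - y) ^+ (r.*2.+1 - k) =
     y ^+ r * (y * (y ^+ (k - r.+1) * (1 - y) ^+ (r.*2.+1 - k))).
    by rewrite !mulrA -exprSr -exprD; congr (_ * _); congr (_ ^+ _); lia.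
  rewrite exprMn ler_wpM2l ?exprn_ge0 //.
  have -> : (1 - y) ^+ r = 1 * ((1 - y) ^+ (k - r.+1) * (1 - y) ^+ (r.*2.+1 - k)).
    by rewrite mul1r -exprD; congr (_ ^+ _); lia.
  have e0 m : 0 <= y ^+ m by rewrite exprn_ge0.
  have e1 m : 0 <= (1 - y) ^+ m by rewrite exprn_ge0.
  apply: ler_pM => //; [by rewrite mulr_ge0 | lra |].
  by apply: ler_wpM2r => //; apply: lerXn2r; rewrite ?nnegrE //; lra.
apply: (@le_trans _ _ (\sum_(k < r.*2.+2) (y * (1 - y)) ^+ r *+ 'C(r.*2.+1, k))).
  rewrite [leRHS](bigID (fun k : 'I__ => (r < k)%N)) /= -[leLHS]addr0 lerD //.
    by apply: ler_sum => k rk; apply: term; rewrite rk ltn_ord.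
  by apply: sumr_ge0 => k _; rewrite mulrn_wge0 // exprn_ge0 // mulr_ge0.
rewrite sumrMnr.
have -> : (\sum_(k < r.*2.+2) 'C(r.*2.+1, k) = 2 * 4 ^ r)%N.
  have := expnDn 1 1 r.*2.+1; rewrite addn1 expnS -mul2n expnM => ->.
  by apply: eq_bigr => k _; rewrite !exp1n !muln1.
rewrite -[leLHS]mulr_natl natrM natrX -mulrA -exprMn ler_wpM2l // lerXn2r ?nnegrE //; nra.
Qed.

Theorem majority_amplifies r y : 0 <= y <= 1 ->
  [/\ 0 <= (majority r).[y] <= 1,
      y <= 1 / 3 -> (majority r).[y] <= 2 * (8 / 9) ^+ r &
      2 / 3 <= y -> 1 - 2 * (8 / 9) ^+ r <= (majority r).[y]].
Proof.
move=> y01; have pos z : 0 <= z <= 1 -> 0 <= (majority r).[z].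
  by move=> z01; rewrite majorityE sumr_ge0 // => k _; exact: binom_term_ge0.
split.
- have h : 0 <= 1 - y <= 1 by lra.
  by rewrite pos //=; have := pos _ h; rewrite majority_compl subr_ge0.
- by move=> y13; apply: majority_le; case/andP: y01 => ->.
move=> y23; have : (majority r).[1 - y] <= 2 * (8 / 9) ^+ r by apply: majority_le; lra.
by rewrite majority_compl; lra.
Qed.

End Majority.

(** * Quantum signal processing *)

Section SignalProcessing.
Variable C : numClosedFieldType.
Implicit Types (f g p q : {poly C}) (u x : C) (l : nat).

(* [z = (P, Q)] stands for the vector [(P, sqrt (1 - x^2) Q)], acted on by the
   reflection [[x, sqrt (1 - x^2)], [sqrt (1 - x^2), -x]] and then by
   [diag (u, u^* )]. *)
Definition qsp_step x u (z : C * C) : C * C :=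
  (u * (x * z.1 + (1 - x ^+ 2) * z.2), u^* * (z.1 - x * z.2)).

Local Notation "p ^cj" := (map_poly Num.conj p) (at level 2, format "p ^cj").

Lemma coef_mul_top m n p q : (size p <= m.+1)%N -> (size q <= n.+1)%N ->
  (p * q)`_(m + n) = p`_m * q`_n.
Proof.
move=> sp sq; rewrite coefM (bigD1 (inord m)) //= inordK ?ltnS ?leq_addr //.
rewrite addKn big1 ?addr0 // => i; rewrite -val_eqE /= inordK ?ltnS ?leq_addr // => im.
have [lim|lmi] := ltnP i m; last first.
  by rewrite nth_default ?mul0r // (leq_trans sp) // ltn_neqAle eq_sym im.
by rewrite [q`__]nth_default ?mulr0 // (leq_trans sq) //; lia.
Qed.

Lemma size_leq_coef0 n p : (size p <= n.+1)%N -> p`_n = 0 -> (size p <= n)%N.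
Proof.
move=> sp pn; apply/leq_sizeP => j; rewrite leq_eqVlt => /orP[/eqP<- //|nj].
by rewrite nth_default // (leq_trans sp).
Qed.

(* With [a], [b] the leading coefficients of [P], [Q], this [u] cancels the top
   degree when the outermost step is undone. *)
Lemma balancing_phase (a b : C) : a * a^* = b * b^* ->
  exists2 u, u * u^* = 1 & u^* * a = u * b.
Proof.
have [->|b0] := eqVneq b 0.
  rewrite mul0r => /eqP; rewrite mulf_eq0 conjC_eq0 orbb => /eqP ->.
  by exists 1; rewrite ?conjC1 ?mulr1 ?mulr0.
move=> ab; pose u := sqrtC (a / b).
have uu : u * u^* = 1.
  rewrite -normCK -normrX sqrtCK normf_div.
  have -> : `|a| = `|b|; last by rewrite divff ?normr_eq0.
  by apply/eqP; rewrite -(@eqrXn2 _ 2) // !normCK ab.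
exists u => //.
have aE : u ^+ 2 * b = a by rewrite sqrtCK divfK.
rewrite -[in LHS]aE; transitivity (u * u^* * (u * b)); first by ring.
by rewrite uu mul1r.
Qed.

Lemma map_conjZ u p : (u *: p)^cj = u^* *: p^cj.
Proof. exact: map_polyZ. Qed.

(** Undoing a step applies the same reflection after the inverse phase. With [a = u^* f] and
    [b = u g] this yields [b + X (a - b)] and [a - b], and [u] is chosen to cancel the leading
    coefficient of [a - b]. *)
Lemma qsp_strip_odd l f g : (size f <= l.+1)%N -> (size g <= l.+1)%N ->
  'X * (f * f^cj) + (1 - 'X) * (g * g^cj) = 1 ->
  exists u f' g', [/\ u * u^* = 1, (size f' <= l.+1)%N, (size g' <= l)%N,
    f' * f'^cj + 'X * (1 - 'X) * (g' * g'^cj) = 1 &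
    forall x, qsp_step x u (f'.[x ^+ 2], x * g'.[x ^+ 2])
              = (x * f.[x ^+ 2], g.[x ^+ 2])].
Proof.
move=> sf sg fg1.
have sc p : size p^cj = size p by exact: size_map_poly.
have top : f`_l * (f`_l)^* = g`_l * (g`_l)^*.
  have := coef_mul_top sf (ltac:(by rewrite sc) : (size f^cj <= l.+1)%N).
  have := coef_mul_top sg (ltac:(by rewrite sc) : (size g^cj <= l.+1)%N).
  rewrite !coef_map /= => <- <-; apply/eqP; rewrite -subr_eq0 -coefB.
  (* The coefficient of degree [2 l] is read one degree higher, after multiplication by [X]: the
     normalisation identifies the product with [1 - g g^cj], whose degree is at most [2 l]. *)
  have -> (p : {poly C}) : p`_(l + l) = ('X * p)`_(l + l).+1 by rewrite coefXM.
  have -> : 'X * (f * f^cj - g * g^cj) = 1 - g * g^cj.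
    by rewrite -fg1; ring.
  rewrite coefB coef1 /= nth_default ?subr0 //.
  by rewrite (leq_trans (size_polyMleq _ _)) // sc; lia.
have [u uu uab] := balancing_phase top.
pose a := u^* *: f; pose b := u *: g.
have sa : (size a <= l.+1)%N by rewrite (leq_trans (size_scale_leq _ _)).
have sb : (size b <= l.+1)%N by rewrite (leq_trans (size_scale_leq _ _)).
have sab : (size (a - b)%R <= l)%N.
  apply: size_leq_coef0; first by size_lia.
  by rewrite coefB !coefZ uab subrr.
have uuP : (u%:P * u^*%:P : {poly C}) = 1 by rewrite -polyCM uu.
exists u, (b + 'X * (a - b)), (a - b); split=> //.
- by size_lia.
- rewrite !(rmorphB, rmorphD, rmorphM) /= map_polyX !map_conjZ conjCK /a /b -!mul_polyC.
  transitivity (u%:P * u^*%:P * ('X * (f * f^cj) + (1 - 'X) * (g * g^cj))).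
    by ring.
  by rewrite uuP fg1 mul1r.
move=> x; rewrite /qsp_step /= !hornerE /=; congr pair.
  transitivity (u * u^* * (x * f.[x ^+ 2])); last by rewrite uu mul1r.
  ring.
transitivity (u * u^* * g.[x ^+ 2]); last by rewrite uu mul1r.
ring.
Qed.

Lemma qsp_strip_even l f g : (size f <= l.+2)%N -> (size g <= l.+1)%N ->
  f * f^cj + 'X * (1 - 'X) * (g * g^cj) = 1 ->
  exists u f' g', [/\ u * u^* = 1, (size f' <= l.+1)%N, (size g' <= l.+1)%N,
    'X * (f' * f'^cj) + (1 - 'X) * (g' * g'^cj) = 1 &
    forall x, qsp_step x u (x * f'.[x ^+ 2], g'.[x ^+ 2])
              = (f.[x ^+ 2], x * g.[x ^+ 2])].
Proof.
move=> sf sg fg1.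
have sc p : size p^cj = size p by exact: size_map_poly.
have top : f`_l.+1 * (f`_l.+1)^* = g`_l * (g`_l)^*.
  have := coef_mul_top sf (ltac:(by rewrite sc) : (size f^cj <= l.+2)%N).
  have := coef_mul_top sg (ltac:(by rewrite sc) : (size g^cj <= l.+1)%N).
  rewrite !coef_map /= => <- <-; apply/eqP; rewrite -subr_eq0.
  rewrite addnS addSn; set q := g * _.
  have -> : f * f^cj = 1 - 'X * q + 'X * ('X * q) by rewrite -fg1 /q; ring.
  rewrite coefD coefB coef1 !coefXM /= [q`_(l + l).+1]nth_default; first by apply/eqP; ring.
  by rewrite (leq_trans (size_polyMleq _ _)) // sc; lia.
have [u uu uab] := balancing_phase top.
pose a := u^* *: f; pose b := u *: g.
have sa : (size a <= l.+2)%N by rewrite (leq_trans (size_scale_leq _ _)).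
have sb : (size b <= l.+1)%N by rewrite (leq_trans (size_scale_leq _ _)).
have sab : (size (a - 'X * b)%R <= l.+1)%N.
  apply: size_leq_coef0; first by size_lia.
  by rewrite coefB coefXM !coefZ uab subrr.
have uuP : (u%:P * u^*%:P : {poly C}) = 1 by rewrite -polyCM uu.
exists u, (a - 'X * b + b), (a - 'X * b); split=> //.
- by size_lia.
- rewrite !(rmorphB, rmorphD, rmorphM) /= map_polyX !map_conjZ conjCK /a /b -!mul_polyC.
  transitivity (u%:P * u^*%:P * (f * f^cj + 'X * (1 - 'X) * (g * g^cj))).
    by ring.
  by rewrite uuP fg1 mul1r.
move=> x; rewrite /qsp_step /= !hornerE /=; congr pair.
  transitivity (u * u^* * f.[x ^+ 2]); last by rewrite uu mul1r.
  ring.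
transitivity (u * u^* * (x * g.[x ^+ 2])); last by rewrite uu mul1r.
ring.
Qed.

(** Odd and even strips alternate, each pair lowering [l] by one. The odd strip at [l = 0] leaves a
    zero second component and a constant first component of modulus 1, which is [t]. *)
Theorem qsp_complete l f g : (size f <= l.+1)%N -> (size g <= l.+1)%N ->
  'X * (f * f^cj) + (1 - 'X) * (g * g^cj) = 1 ->
  exists us : seq C, exists t : C, [/\ size us = l.*2.+1,
    {in us, forall u, u * u^* = 1}, t * t^* = 1 &
    forall x, foldr (qsp_step x) (t, 0) us = (x * f.[x ^+ 2], g.[x ^+ 2])].
Proof.
elim: l f g => [|l IH] f g sf sg fg1.
  have [u [f' [g' [uu sf' sg' fg1' step]]]] := qsp_strip_odd sf sg fg1.
  move: sg'; rewrite leqn0 size_poly_eq0 => /eqP g'0.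
  move: fg1' step; rewrite (size1_polyC sf') g'0 rmorph0 !mulr0 addr0 => fg1' step.
  exists [:: u], f'`_0; split=> //; first by move=> v; rewrite inE => /eqP->.
    have := congr1 (horner^~ 0) fg1'.
    by rewrite map_polyC /= !hornerE.
  by move=> x /=; have := step x; rewrite !hornerE.
have [u [f' [g' [uu sf' sg' fg1' step]]]] := qsp_strip_odd sf sg fg1.
have [w [f2 [g2 [ww sf2 sg2 fg12 step2]]]] := qsp_strip_even sf' sg' fg1'.
have [us [t [sus uus tt ust]]] := IH _ _ sf2 sg2 fg12.
exists [:: u, w & us], t; split=> //=; first by rewrite sus doubleS.
  by move=> v; rewrite !inE => /or3P[/eqP->|/eqP->|/uus].
by move=> x; rewrite ust step2 step.
Qed.

Lemma qsp_step_scale x u (t : C) z :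
  qsp_step x u (t * z.1, t * z.2) = (t * (qsp_step x u z).1, t * (qsp_step x u z).2).
Proof. by rewrite /qsp_step /=; congr pair; ring. Qed.

Lemma foldr_qsp_scale x (t : C) us :
  foldr (qsp_step x) (t, 0) us =
  (t * (foldr (qsp_step x) (1, 0) us).1, t * (foldr (qsp_step x) (1, 0) us).2).
Proof. by elim: us => [|u us /= ->]; rewrite /= ?mulr1 ?mulr0 // qsp_step_scale. Qed.

End SignalProcessing.

Section RealSignalProcessing.
Variable R : rcfType.

Lemma map_conj_real (p : {poly R}) :
  map_poly Num.conj (map_poly (real_complex R) p) = map_poly (real_complex R) p.
Proof.
by apply/polyP => i; rewrite !coef_map /=; apply/eqP; rewrite eq_complex /= oppr0 !eqxx.
Qed.

Theorem real_qsp l (h : {poly R}) : (size h <= l.+1)%N ->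
  (forall y, 0 < y < 1 -> y * h.[y] ^+ 2 <= 1) ->
  exists us : seq R[i], [/\ size us = l.*2.+1,
    {in us, forall u, u * u^* = 1} &
    forall x : R, complex.Re (foldr (qsp_step x%:C%C) (1, 0) us).1 = x * h.[x ^+ 2]].
Proof.
move=> sh h1; pose G := 1 - 'X * h ^+ 2.
have sG : (size G <= l.*2.+1.+1)%N by rewrite /G expr2; size_lia.
(* The odd bound [2 l + 1] selects the shape [X a^2 + (1 - X) b^2], with [a] and [b] of degree at
   most [l]. *)
have : lukacs l.*2.+1 G.
  apply: lukacs_nonneg => // y y01.
  by rewrite /G -polyC1 hornerD hornerN hornerM hornerX horner_exp hornerC subr_ge0 h1.
rewrite /lukacs /= odd_double /= uphalf_double => -[a [b [sa sb GE]]].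
pose rc := map_poly (real_complex R).
have rcE p x : (rc p).[x%:C%C] = (p.[x])%:C%C by rewrite horner_map.
have src p : size (rc p) = size p by exact: size_map_poly.
pose f := rc h + ('i : R[i])%:P * rc a.
have sf : (size f <= l.+1)%N.
  have := src h; have := src a; rewrite /f => e1 e2.
  have := leq_trans (eq_leq e1) sa; have := leq_trans (eq_leq e2) sh => k1 k2.
  by size_lia.
have [||us [t [sus uus tt ust]]] := @qsp_complete R[i] l f (rc b) sf _ _.
- by rewrite src.
- have ii : ('i * 'i : R[i]) = -1 by rewrite -expr2 sqrCi.
  have iP : (('i : R[i])%:P * 'i%:P) = - 1 :> {poly R[i]}.
    by rewrite -polyCM ii polyCN.
  rewrite /f rmorphD rmorphM /= !map_conj_real map_polyC /= conjCi polyCN.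
  transitivity ('X * (rc h ^+ 2 + - ('i%:P * 'i%:P) * rc a ^+ 2) + (1 - 'X) * rc b ^+ 2).
    by ring.
  rewrite iP opprK mul1r; have := congr1 rc GE.
  rewrite /rc /G !(rmorphB, rmorphD, rmorphM, rmorphXn) /= !map_polyX !rmorph1 => E.
  by rewrite mulrDr -addrA -E; ring.
case: us sus uus ust => // u us /= sus uus ust.
(* The phase [t] scales both components throughout; merged into the outermost [u], it gives the
   right first component, whose real part is claimed. *)
exists [:: t * u & us]; split=> //=.
  move=> v; rewrite inE => /orP[/eqP->|vus]; last by apply: uus; rewrite inE vus orbT.
  by rewrite rmorphM mulrACA tt mul1r uus // inE eqxx.
move=> x; have := ust x%:C%C; rewrite foldr_qsp_scale.
set z := foldr _ (1, 0) us; rewrite qsp_step_scale => -[E _].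
have -> : t * u * (x%:C%C * z.1 + (1 - x%:C%C ^+ 2) * z.2) = x%:C%C * f.[x%:C%C ^+ 2].
  by rewrite -E; ring.
rewrite -rmorphXn /= /f hornerD hornerM hornerC !rcE mulrDr mulrCA -!rmorphM raddfD /=.
by rewrite ?(mul0r, mulr0, subr0, mul1r, addr0, sub0r, oppr0).
Qed.

End RealSignalProcessing.

(** * The amplifying polynomial and its phases *)

Section Amplification.
Variable R : realType.

Theorem amplifying_polynomial (gamma delta eps : R) (n r : nat) :
  1 < gamma -> 0 < delta < 1 -> 0 < eps < 1 ->
  6 <= n%:R * (delta / gamma) -> 2 * (8 / 9) ^+ r <= eps / gamma ->
  exists h : {poly R}, [/\ (size h <= (r.*2.+1 * n.-1).+1)%N,
    forall y, 0 < y < 1 -> y * h.[y] ^+ 2 <= 1 &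
    forall x, 0 <= x <= (1 - delta) / gamma ->
      exists2 rho, h.[x ^+ 2] = gamma * rho & `|rho - 1| <= eps].
Proof.
move=> g1 /andP[d0 d1] /andP[e0 e1] nd rg.
have g0 : 0 < gamma by lra.
have gV0 : 0 < gamma^-1 by rewrite invr_gt0.
have gV1 : gamma^-1 < 1 by rewrite invf_lt1.
have a0 : 0 <= (1 - delta) / gamma by rewrite divr_ge0 //; lra.
have a1 : (1 - delta) / gamma <= 1.
  by rewrite ler_pdivrMr //; lra.
have [q [sq q01 qa qb]] : exists q : {poly R}, [/\ (size q <= n)%N,
    forall y, 0 <= y <= 1 -> 0 <= q.[y] <= 1,
    forall y, 0 <= y <= 1 -> y <= ((1 - delta) / gamma) ^+ 2 -> 2 / 3 <= q.[y] &
    forall y, 0 <= y <= 1 -> 0 <= gamma^-1 -> gamma^-1 ^+ 2 <= y -> q.[y] <= 1 / 3].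
  apply: step_polynomial => //.
  by have -> : gamma^-1 - (1 - delta) / gamma = delta / gamma by field; rewrite gt_eqF.
(* The tolerance [eps / gamma] serves twice: it is at most [1 / gamma], for boundedness beyond
   [1 / gamma], and at most [eps], for accuracy below the threshold. *)
have rg1 : 2 * (8 / 9) ^+ r <= gamma^-1 :> R.
  by apply: le_trans rg _; rewrite ler_piMl // ?(ltW gV0) // ltW.
have rge : 2 * (8 / 9) ^+ r <= eps :> R.
  by apply: le_trans rg _; rewrite ler_piMr // ltW.
exists (gamma *: (majority R r \Po q)); split.
- apply: (leq_trans (size_scale_leq _ _)); apply: (leq_trans (size_comp_poly_leq _ _)).
  rewrite ltnS leq_mul //; last by rewrite -!subn1 leq_sub2r.
  by rewrite -subn1 leq_subLR add1n size_majority.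
- move=> y /andP[/ltW y0 /ltW y1]; rewrite hornerZ horner_comp.
  have y01 : 0 <= y <= 1 by rewrite y0.
  have [/andP[m0 m1] mlow _] := majority_amplifies r (q01 y y01).
  rewrite exprMn mulrA; set m := (majority R r).[_] in m0 m1 mlow *.
  have [yb|/ltW yb] := leP y (gamma^-1 ^+ 2).
    have : y * gamma ^+ 2 <= 1.
      by rewrite -ler_pdivlMr ?exprn_gt0 // div1r -exprVn.
    have : m ^+ 2 <= 1 by rewrite expr_le1.
    have : 0 <= m ^+ 2 by rewrite sqr_ge0.
    have : 0 <= y * gamma ^+ 2 by rewrite mulr_ge0 ?sqr_ge0.
    move: (y * _) (m ^+ 2) => u w; nra.
  have mg : m <= gamma^-1 by apply: le_trans rg1; apply: mlow; apply: qb => //; exact: ltW.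
  have : m * gamma <= 1 by rewrite -ler_pdivlMr // div1r.
  move=> h; have : (m * gamma) ^+ 2 <= 1 by rewrite expr_le1 // mulr_ge0 // ltW.
  have : 0 <= (m * gamma) ^+ 2 by rewrite sqr_ge0.
  rewrite -mulrA -exprMn (mulrC gamma); move: (_ ^+ 2) => w; nra.
move=> x /andP[x0 xa]; rewrite hornerZ horner_comp.
have x1 : x <= 1 by apply: le_trans a1.
have y01 : 0 <= x ^+ 2 <= 1 by rewrite sqr_ge0 expr_le1.
have [/andP[m0 m1] _ mhigh] := majority_amplifies r (q01 _ y01).
exists (majority R r).[q.[x ^+ 2]] => //.
have xa2 : x ^+ 2 <= ((1 - delta) / gamma) ^+ 2 by rewrite lerXn2r ?nnegrE.
by have := mhigh (qa _ y01 xa2); rewrite ler_norml; lra.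
Qed.

Theorem amplifying_phases (gamma delta eps : R) (n r : nat) :
  1 < gamma -> 0 < delta < 1 -> 0 < eps < 1 ->
  6 <= n%:R * (delta / gamma) -> 2 * (8 / 9) ^+ r <= eps / gamma ->
  exists us : seq R[i], [/\ size us = (r.*2.+1 * n.-1).*2.+1,
    {in us, forall u, u * u^* = 1} &
    forall x, 0 <= x <= (1 - delta) / gamma -> exists2 rho,
      complex.Re (foldr (qsp_step x%:C%C) (1, 0) us).1 = gamma * x * rho &
      `|rho - 1| <= eps].
Proof.
move=> g1 d01 e01 nd rg.
have [h [sh h1 hx]] := amplifying_polynomial g1 d01 e01 nd rg.
have [us [sus uus ust]] := real_qsp sh h1.
exists us; split=> // x /hx[rho hE rho1]; exists rho => //.
by rewrite ust hE; ring.
Qed.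

End Amplification.

(** * Singular vectors and the circuit *)

Import Rstruct.

Section Matrices.
Local Notation R := Rdefinitions.R.
Local Notation CC := (complex R).
Implicit Types (N n k : nat) (A B U P : Defs.Mat) (u v w : Defs.Vec).

Definition toC (z : Defs.C) : CC := Complex (Defs.Re z) (Defs.Im z).

Lemma toC_inj : injective toC.
Proof. by move=> [a b] [c d] [-> ->]. Qed.

Lemma toCD x y : toC (Defs.Cadd x y) = toC x + toC y.
Proof. by []. Qed.

Lemma toCM x y : toC (Defs.Cmul x y) = toC x * toC y.
Proof. by []. Qed.

Lemma toC_csum n f : toC (Defs.csum n f) = \sum_(i < n) toC (f i).
Proof. by elim: n => [|n IH]; rewrite ?big_ord0 // big_ord_recr /= toCD IH. Qed.

Definition mx N A : 'M[CC]_N := \matrix_(i, j) toC (A i j).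
Definition cv N v : 'cV[CC]_N := \col_i toC (v i).
Definition adj m n (M : 'M[CC]_(m, n)) : 'M[CC]_(n, m) := map_mx Num.conj M^T.

Lemma adjM m n p (M : 'M[CC]_(m, n)) (M' : 'M[CC]_(n, p)) :
  adj (M *m M') = adj M' *m adj M.
Proof. by rewrite /adj trmx_mul map_mxM. Qed.

Lemma adjK m n (M : 'M[CC]_(m, n)) : adj (adj M) = M.
Proof. by apply/matrixP => i j; rewrite !mxE conjCK. Qed.

Lemma adjZ m n (c : CC) (M : 'M[CC]_(m, n)) : adj (c *: M) = c^* *: adj M.
Proof. by apply/matrixP => i j; rewrite !mxE rmorphM. Qed.

Lemma adj_sum m n k (F : 'I_k -> 'M[CC]_(m, n)) : adj (\sum_i F i) = \sum_i adj (F i).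
Proof.
by apply/matrixP => i j; rewrite !mxE !summxE rmorph_sum; apply: eq_bigr => l _; rewrite !mxE.
Qed.

Lemma mat_eqP N A B : Defs.mat_eq N N A B <-> mx N A = mx N B.
Proof.
split=> [AB|/matrixP AB i j /ssrnat.ltP Hi /ssrnat.ltP Hj].
  by apply/matrixP => i j; rewrite !mxE AB //; apply/ssrnat.ltP.
by have := AB (Ordinal Hi) (Ordinal Hj); rewrite !mxE => /toC_inj.
Qed.

Lemma mx_mul N A B : mx N (Defs.mmul N A B) = mx N A *m mx N B.
Proof.
apply/matrixP => i j; rewrite !mxE toC_csum.
by apply: eq_bigr => k _; rewrite !mxE.
Qed.

Lemma mx_add N A B : mx N (Defs.madd A B) = mx N A + mx N B.
Proof. by apply/matrixP => i j; rewrite !mxE. Qed.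

Lemma mx_opp N A : mx N (Defs.mopp A) = - mx N A.
Proof. by apply/matrixP => i j; rewrite !mxE. Qed.

Lemma mx_scale N c A : mx N (Defs.mscale c A) = toC c *: mx N A.
Proof. by apply/matrixP => i j; rewrite !mxE. Qed.

Lemma mx_idm N : mx N Defs.idm = 1%:M.
Proof.
apply/matrixP => i j; rewrite !mxE /Defs.idm -val_eqE /=.
by case: PeanoNat.Nat.eqb_spec => [->|/eqP/negPf->]; rewrite ?eqxx.
Qed.

Lemma mx_adjoint N A : mx N (Defs.adjoint A) = adj (mx N A).
Proof. by apply/matrixP => i j; rewrite !mxE. Qed.

Lemma mx_zero N : mx N Defs.mzero = 0.
Proof. by apply/matrixP => i j; rewrite !mxE. Qed.

Lemma mx_msum N n (F : nat -> Defs.Mat) : mx N (Defs.msum n F) = \sum_(i < n) mx N (F i).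
Proof.
apply/matrixP => i j; rewrite summxE !mxE toC_csum.
by apply: eq_bigr => k _; rewrite !mxE.
Qed.

Lemma mx_outer N u v : mx N (Defs.outer u v) = cv N u *m adj (cv N v).
Proof. by apply/matrixP => i j; rewrite !mxE big_ord1 !mxE. Qed.

Lemma inner_cv N u v : adj (cv N u) *m cv N v = (toC (Defs.inner N u v))%:M.
Proof.
apply/matrixP => i j; rewrite !mxE !ord1 eqxx mulr1n toC_csum.
by apply: eq_bigr => k _; rewrite !mxE.
Qed.

Lemma proj_image N P v : mx N P *m mx N P = mx N P -> Defs.in_image N P v ->
  mx N P *m cv N v = cv N v.
Proof.
move=> PP [y vE]; have -> : cv N v = mx N P *m cv N y; last by rewrite mulmxA PP.
apply/matrixP => i j; rewrite !mxE vE; last exact/ssrnat.ltP.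
by rewrite /Defs.mvmul toC_csum; apply: eq_bigr => k _; rewrite !mxE.
Qed.

Definition expi (phi : R) : CC := Complex (Rtrigo_def.cos phi) (Rtrigo_def.sin phi).

Lemma expiN phi : expi (- phi) = (expi phi)^*.
Proof. by rewrite /expi Rtrigo1.cos_neg Rtrigo1.sin_neg. Qed.

Lemma mx_phase N phi P : mx N P *m mx N P = mx N P ->
  mx N (Defs.phase N phi P) = expi phi *: mx N P + (expi phi)^* *: (1%:M - mx N P).
Proof.
move=> PP; set Z := Defs.madd (Defs.mscale (Defs.RtoC (1 + 1)) P) (Defs.mopp Defs.idm).
have toC2 : toC (Defs.RtoC (1 + 1)) = 2 by apply/eqP; rewrite eq_complex /= addr0 !eqxx.
have ZE : mx N Z = 2 *: mx N P - 1%:M.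
  by rewrite mx_add mx_opp mx_scale mx_idm toC2.
have ZZ : Defs.mat_eq N N (Defs.mmul N Z Z) Defs.idm.
  apply/mat_eqP; rewrite mx_mul mx_idm ZE mulmxBl mulmxBr mul1mx mulmx1.
  rewrite -scalemxAl -scalemxAr PP scalerA; apply/matrixP => i j; rewrite !mxE; ring.
apply/matrixP => i j; rewrite mxE /Defs.phase.
rewrite (mexp_involution _ _ _ _ _ _ _ ZZ); try exact/ssrnat.ltP.
rewrite toCD !toCM.
have -> : toC (Z i j) = (mx N Z) i j by rewrite mxE.
have -> : toC (Defs.idm i j) = (mx N Defs.idm) i j by rewrite mxE.
rewrite mx_idm ZE !mxE.
set c := toC (Defs.RtoC _); set s := toC (Defs.mkC _ _).
have -> : expi phi = c + s by apply/eqP; rewrite eq_complex /= addr0 add0r !eqxx.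
have -> : (c + s)^* = c - s.
  by apply/eqP; rewrite eq_complex /= oppr0 !addr0 !add0r !eqxx.
ring.
Qed.

Lemma phase_fix N phi P (z : 'cV_N) : mx N P *m mx N P = mx N P ->
  mx N P *m z = z -> mx N (Defs.phase N phi P) *m z = expi phi *: z.
Proof.
move=> PP Pz; rewrite mx_phase // mulmxDl -!scalemxAl mulmxBl mul1mx Pz.
by rewrite subrr scaler0 addr0.
Qed.

Lemma phase_kernel N phi P (z : 'cV_N) : mx N P *m mx N P = mx N P ->
  mx N P *m z = 0 -> mx N (Defs.phase N phi P) *m z = (expi phi)^* *: z.
Proof.
move=> PP Pz; rewrite mx_phase // mulmxDl -!scalemxAl mulmxBl mul1mx Pz.
by rewrite subr0 scaler0 add0r.
Qed.

(* The plane spanned by [v] and [V w] is mapped by [U] to the plane spanned by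
   [w] and [U v]; in these (unnormalised) bases no square root of [1 - x^2]
   appears, and [w = 0], [x = 0] covers the unpaired singular vectors. *)
Definition signal_state N (V : 'M[CC]_N) (v w : 'cV[CC]_N) (x : CC) (z : CC * CC) :=
  z.1 *: v + z.2 *: (V *m w - x *: v).

(** [U] sends [v] to [x w + y] with [w] in the image of [P] and [y = U v - x w] in its kernel, so
    the phase acts diagonally on [w] and [y]. *)
Lemma signal_step N phi P (U V : 'M[CC]_N) (v w : 'cV_N) (x : CC) z :
  mx N P *m mx N P = mx N P -> U *m V = 1%:M ->
  mx N P *m w = w -> mx N P *m (U *m v) = x *: w ->
  mx N (Defs.phase N phi P) *m (U *m signal_state V v w x z) =
  signal_state U w v x (qsp_step x (expi phi) z).
Proof.
move=> PP UV Pw PUv; rewrite /signal_state /qsp_step /=.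
set y := U *m v - x *: w.
have -> : U *m (z.1 *: v + z.2 *: (V *m w - x *: v)) =
    (x * z.1 + (1 - x ^+ 2) * z.2) *: w + (z.1 - x * z.2) *: y.
  rewrite mulmxDr -!scalemxAr mulmxBr mulmxA UV mul1mx -scalemxAr /y.
  by apply/matrixP => i j; rewrite !mxE; ring.
rewrite mulmxDr -!scalemxAr phase_fix // phase_kernel //; last first.
  by rewrite /y mulmxBr PUv -scalemxAr Pw subrr.
by rewrite !scalerA [_ * expi phi]mulrC [_ * (expi phi)^*]mulrC.
Qed.

Section Sequence.
Variables (N : nat) (U P Pt : Defs.Mat) (v w : 'cV[CC]_N) (x : CC) (Phi : nat -> R).
Hypotheses (PP : mx N P *m mx N P = mx N P) (PtPt : mx N Pt *m mx N Pt = mx N Pt).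
Hypotheses (UV : mx N U *m adj (mx N U) = 1%:M) (VU : adj (mx N U) *m mx N U = 1%:M).
Hypotheses (Pv : mx N P *m v = v) (Ptw : mx N Pt *m w = w).
Hypotheses (PtUv : mx N Pt *m (mx N U *m v) = x *: w).
Hypotheses (PVw : mx N P *m (adj (mx N U) *m w) = x *: v).

(** The rightmost factor acts first, as in [foldr]. The product runs over [j] from 1 to [k] and uses
    [Phi 1] to [Phi (2 k)]; [Phi 0] belongs to the factor in front of it. *)
Lemma mprod_state k z :
  mx N (Defs.mprod N k (fun j => Defs.mmul N (Defs.mmul N (Defs.mmul N
      (Defs.phase N (Phi (Nat.sub (Nat.mul 2 j) 1)) P) (Defs.adjoint U))
      (Defs.phase N (Phi (Nat.sub (Nat.add (Nat.mul 2 j) 1) 1)) Pt)) U))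
    *m signal_state (adj (mx N U)) v w x z =
  signal_state (adj (mx N U)) v w x
    (foldr (qsp_step x) z [seq expi (Phi j) | j <- iota 1 k.*2]).
Proof.
elim: k z => [|k IH] z; first by rewrite mx_idm mul1mx.
rewrite doubleS -[k.*2.+2]addn2 iotaD map_cat foldr_cat /= !mx_mul mx_adjoint -!mulmxA.
rewrite (signal_step _ _ _ UV) // (signal_step _ _ _ VU) // IH.
congr (signal_state _ _ _ _ (foldr _ _ _)).
congr (qsp_step _ (expi (Phi _)) (qsp_step _ (expi (Phi _)) _)); lia.
Qed.

Lemma UPhi_state k : mx N (Defs.UPhi N U P Pt k.*2.+1 Phi) *m v =
  signal_state (mx N U) w v x
    (foldr (qsp_step x) (1, 0) [seq expi (Phi j) | j <- iota 0 k.*2.+1]).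
Proof.
have vE : v = signal_state (adj (mx N U)) v w x (1, 0).
  by rewrite /signal_state /= scale1r scale0r addr0.
have -> : Defs.UPhi N U P Pt k.*2.+1 Phi = Defs.mmul N
    (Defs.mmul N (Defs.phase N (Phi 0) Pt) U)
    (Defs.mprod N k (fun j => Defs.mmul N (Defs.mmul N (Defs.mmul N
      (Defs.phase N (Phi (Nat.sub (Nat.mul 2 j) 1)) P) (Defs.adjoint U))
      (Defs.phase N (Phi (Nat.sub (Nat.add (Nat.mul 2 j) 1) 1)) Pt)) U)).
  rewrite /Defs.UPhi; congr (Defs.mmul _ _ (Defs.mprod _ _ _)).
  have -> : Nat.sub k.*2.+1 1 = Nat.mul k 2 by lia.
  by rewrite PeanoNat.Nat.div_mul.
rewrite !mx_mul {1}vE -!mulmxA mprod_state (signal_step _ _ _ UV) //.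
Qed.

(** [Pt] annihilates the second basis vector [U v - x w], so only the first coordinate remains. *)
Lemma UPhi_amplitude k : mx N Pt *m (mx N (Defs.UPhi N U P Pt k.*2.+1 Phi) *m v) =
  (foldr (qsp_step x) (1, 0) [seq expi (Phi j) | j <- iota 0 k.*2.+1]).1 *: w.
Proof.
rewrite UPhi_state /signal_state mulmxDr -!scalemxAr Ptw mulmxBr PtUv.
by rewrite -scalemxAr Ptw subrr scaler0 addr0.
Qed.

End Sequence.

(** Negating all phases conjugates the amplitude at a real signal, so averaging the two circuits
    keeps its real part. *)
Lemma foldr_qsp_conj (x : CC) (us : seq CC) : x^* = x ->
  foldr (qsp_step x) (1, 0) [seq c^* | c <- us] =
  ((foldr (qsp_step x) (1, 0) us).1^*, (foldr (qsp_step x) (1, 0) us).2^*).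
Proof.
move=> xr; elim: us => [|u us /= ->]; first by rewrite /= conjC1 conjC0.
rewrite /qsp_step /=; congr pair; last by rewrite rmorphM rmorphB rmorphM /= xr.
by rewrite rmorphM rmorphD !rmorphM rmorphB rmorph1 rmorphXn /= xr.
Qed.

Lemma conj_real_complex (a : R) : (a%:C%C)^* = a%:C%C.
Proof. by apply/eqP; rewrite eq_complex /= oppr0 !eqxx. Qed.

Lemma half_addc_conj (c : CC) : toC (Defs.RtoC (1 + 1)^-1) * (c + c^*) = (complex.Re c)%:C%C.
Proof.
case: c => a b; apply/eqP; rewrite eq_complex /= !(mul0r, subrr, addr0, mulr0, subr0).
by rewrite eqxx andbT; apply/eqP; field.
Qed.

Lemma expi_surj (us : seq CC) : {in us, forall c, c * c^* = 1} ->
  exists Phi : nat -> R, us = [seq expi (Phi j) | j <- iota 0 (size us)].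
Proof.
elim: us => [|c us IH] uus; first by exists (fun=> 0).
have [|Phi usE] := IH; first by move=> z zus; apply: uus; rewrite inE zus orbT.
have [phi [cE sE]] : exists phi, Rtrigo_def.cos phi = complex.Re c /\
    Rtrigo_def.sin phi = complex.Im c.
  apply: unit_angle; have := uus c (mem_head _ _); case: (c) => a b [/= ab _].
  by rewrite -[RHS]ab mulrN opprK.
exists (fun j => if j is j'.+1 then Phi j' else phi) => /=; congr (_ :: _).
  by rewrite /expi cE sE; case: (c).
by rewrite -[1%N]addn0 iotaDl -map_comp {1}usE.
Qed.

Theorem singular_value_transformation (N : nat) (U P Pt : Defs.Mat) (d dt : nat)
    (v w : nat -> Defs.Vec) (s : nat -> R) (t : R) (us : seq CC) :
  Defs.unitary N U -> Defs.orth_proj N P -> Defs.orth_proj N Pt ->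
  Defs.orthonormal_basis_of_img N P d v -> Defs.orthonormal_basis_of_img N Pt dt w ->
  Defs.mat_eq N N (Defs.mmul N (Defs.mmul N Pt U) P)
    (Defs.msum (Nat.min d dt) (fun i => Defs.mscale (Defs.RtoC (s i)) (Defs.outer (w i) (v i)))) ->
  odd (size us) -> {in us, forall c, c * c^* = 1} ->
  let s' := Defs.sig_ext (Nat.min d dt) s in
  exists Phi : nat -> R, Defs.mat_eq N N
    (Defs.mmul N (Defs.mmul N (Defs.thr_proj dt w s' t)
       (half_sum (Defs.UPhi N U P Pt (size us) Phi)
                   (Defs.UPhi N U P Pt (size us) (fun j => Rdefinitions.Ropp (Phi j)))))
       (Defs.thr_proj d v s' t))
    (Defs.msum (Nat.min d dt) (fun i => match RIneq.Rle_dec (s' i) t with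
       | left _ => Defs.mscale (Defs.RtoC (complex.Re (foldr (qsp_step (s i)%:C%C) (1, 0) us).1))
                     (Defs.outer (w i) (v i))
       | right _ => Defs.mzero
       end)).
Proof.
move=> [/mat_eqP VU /mat_eqP UV] [/mat_eqP PP /mat_eqP Padj] [/mat_eqP PtPt /mat_eqP Ptadj].
move=> [vv [vP _]] [ww [wPt _]] /mat_eqP svd odd_us uus s'.
have [Phi usE] := expi_surj uus; exists Phi; apply/mat_eqP.
set r := Nat.min d dt in svd s' *.
have [rd rdt] : (r <= d)%N /\ (r <= dt)%N by rewrite /r; lia.
have [k sz] : exists k, size us = k.*2.+1.
  by exists (size us)./2; rewrite -[LHS]odd_double_half odd_us.
rewrite sz in usE *.
rewrite !(mx_mul, mx_adjoint, mx_idm) in VU UV PP Padj PtPt Ptadj svd *.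
rewrite mx_msum in svd.
pose v_ i := cv N (v i); pose w_ i := cv N (w i).
have delta (n : nat) (z : nat -> Defs.Vec) :
    (forall i j, (i < n)%coq_nat -> (j < n)%coq_nat ->
      Defs.inner N (z i) (z j) = (if PeanoNat.Nat.eqb i j then Defs.C1 else Defs.C0)) ->
    forall i j, (i < n)%N -> (j < n)%N -> adj (cv N (z i)) *m cv N (z j) = (i == j)%:R%:M.
  move=> zz i j Hi Hj; rewrite inner_cv zz; try exact/ssrnat.ltP.
  by case: PeanoNat.Nat.eqb_spec => [->|/eqP/negPf->]; rewrite ?eqxx.
have {}vv := delta _ _ vv; have {}ww := delta _ _ ww.
have Pv i : (i < d)%N -> mx N P *m v_ i = v_ i.
  by move=> Hi; apply: proj_image => //; apply: vP; apply/ssrnat.ltP.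
have Ptw i : (i < dt)%N -> mx N Pt *m w_ i = w_ i.
  by move=> Hi; apply: proj_image => //; apply: wPt; apply/ssrnat.ltP.
(* With [W i = 0] beyond [r], the unpaired [v_ i] follow the same argument at signal [x i = 0]. *)
pose W i := if (i < r)%N then w_ i else 0.
pose x i : CC := (s' i)%:C%C.
have xE i : (i < r)%N -> x i = toC (Defs.RtoC (s i)).
  by move=> /ssrnat.ltP/PeanoNat.Nat.ltb_lt ir; rewrite /x /s' /Defs.sig_ext ir.
have pick (F : nat -> 'cV[CC]_N) i :
    \sum_(j < r) F j *m ((j == i :> nat)%:R%:M : 'M_1) = if (i < r)%N then F i else 0.
  case: ifP => ir; last first.
    apply: big1 => j _; rewrite (_ : (_ == _) = false) ?mul_mx_scalar ?scale0r //.
    by apply/eqP => ji; rewrite -ji ltn_ord in ir.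
  rewrite (bigD1 (Ordinal ir)) //= eqxx mulmx1 big1 ?addr0 // => j.
  by rewrite -val_eqE /= => /negPf->; rewrite mul_mx_scalar scale0r.
have PtUv i : (i < d)%N -> mx N Pt *m (mx N U *m v_ i) = x i *: W i.
  move=> Hi; rewrite -[v_ i]Pv // !mulmxA svd mulmx_suml.
  transitivity (\sum_(j < r) (x j *: w_ j) *m ((j == i :> nat)%:R%:M : 'M_1)).
    apply: eq_bigr => j _; rewrite mx_scale mx_outer -xE //.
    by rewrite -!scalemxAl -mulmxA vv // (leq_trans _ rd).
  by rewrite (pick (fun j => x j *: w_ j)) /W; case: ifP; rewrite ?scaler0.
have PVw i : (i < d)%N -> mx N P *m (adj (mx N U) *m W i) = x i *: v_ i.
  move=> Hi; rewrite /W; case: ifP => ir; last first.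
    rewrite !mulmx0 /x /s' /Defs.sig_ext; case: PeanoNat.Nat.ltb_spec0 => [/ssrnat.ltP|_].
      by rewrite ir.
    by rewrite scale0r.
  rewrite -[w_ i]Ptw ?(leq_trans ir) // !mulmxA -{1}Padj -{1}Ptadj -!adjM mulmxA svd.
  rewrite adj_sum mulmx_suml.
  transitivity (\sum_(j < r) (x j *: v_ j) *m ((j == i :> nat)%:R%:M : 'M_1)).
    apply: eq_bigr => j _; rewrite mx_scale mx_outer -xE // adjZ conj_real_complex adjM adjK.
    by rewrite -!scalemxAl -mulmxA ww // ?(leq_trans _ rdt) // (leq_trans ir).
  by rewrite (pick (fun j => x j *: v_ j)) ir.
pose T := mx N (Defs.thr_proj dt w s' t).
have TE : T = \sum_(j < dt) if RIneq.Rle_dec (s' j) t then w_ j *m adj (w_ j) else 0.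
  rewrite /T mx_msum; apply: eq_bigr => j _.
  by case: RIneq.Rle_dec => ? /=; rewrite ?mx_outer ?mx_zero.
(* This allows [Pt] to be inserted in front of the circuit, where [UPhi_amplitude] needs it. *)
have TPt : T *m mx N Pt = T.
  rewrite TE mulmx_suml; apply: eq_bigr => j _.
  case: RIneq.Rle_dec => ? /=; last by rewrite mul0mx.
  by rewrite -mulmxA -{1}Ptadj -adjM Ptw.
have TW i : T *m W i = if RIneq.Rle_dec (s' i) t then W i else 0.
  rewrite /W; case: ifP => ir; last by rewrite mulmx0; case: RIneq.Rle_dec.
  have Hi : (i < dt)%N by rewrite (leq_trans ir).
  rewrite TE mulmx_suml (bigD1 (Ordinal Hi)) //= big1 ?addr0 => [|j].
    case: RIneq.Rle_dec => ? /=; last by rewrite mul0mx.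
    by rewrite -mulmxA ww // eqxx mulmx1.
  rewrite -val_eqE /= => /negPf ji.
  case: RIneq.Rle_dec => ? /=; last by rewrite mul0mx.
  by rewrite -mulmxA ww // ji mul_mx_scalar scale0r.
pose st i := complex.Re (foldr (qsp_step (x i)) (1, 0) us).1.
set H := mx N (half_sum _ _).
have Hv i : (i < d)%N -> mx N Pt *m (H *m v_ i) = (st i)%:C%C *: W i.
  move=> Hi; rewrite /H mx_scale mx_add -scalemxAl mulmxDl -scalemxAr mulmxDr.
  have PtW : mx N Pt *m W i = W i.
    by rewrite /W; case: ifP => ir; rewrite ?mulmx0 // Ptw // (leq_trans ir).
  have amp := UPhi_amplitude _ PP PtPt UV VU (Pv _ Hi) PtW (PtUv _ Hi) (PVw _ Hi).
  rewrite !amp -usE -scalerDl scalerA -half_addc_conj; congr (_ * (_ + _) *: _).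
  transitivity (foldr (qsp_step (x i)) (1, 0) [seq c^* | c <- us]).1; last first.
    by rewrite (foldr_qsp_conj us (conj_real_complex (s' i))).
  rewrite [in RHS]usE -map_comp; congr (foldr _ _ _).1.
  by apply: eq_map => j; exact: expiN.
pose G i := if RIneq.Rle_dec (s' i) t then (st i)%:C%C *: (w_ i *m adj (v_ i)) else 0.
transitivity (\sum_(i < r) G i); last first.
  rewrite mx_msum; apply: eq_bigr => i _; rewrite /G.
  by case: RIneq.Rle_dec => ? /=; rewrite ?mx_zero // mx_scale mx_outer /st xE.
(* The left side sums over all [d] vectors [v_ i]; its terms beyond [r] vanish because [W i = 0],
   and the right side is padded by zeros to match. *)
rewrite -/T -TPt mx_msum mulmx_sumr (big_ord_widen d G) // [RHS]big_mkcond.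
apply: eq_bigr => i _ /=; have := TW i; rewrite /G.
case: RIneq.Rle_dec => ? /= TWi; last by rewrite mx_zero mulmx0 if_same.
rewrite mx_outer !mulmxA -(mulmxA (T *m _)) -(mulmxA T) Hv // -scalemxAr TWi.
by rewrite /W; case: ifP => ir; rewrite -scalemxAl ?mul0mx ?scaler0.
Qed.

End Matrices.

Local Open Scope R_scope.

Theorem singular_value_amplification (N : nat) (U P Pt : Defs.Mat)
    (gamma delta eps : R) (d dt : nat) (v w : nat -> Defs.Vec) (s : nat -> R) (n r : nat) :
  Defs.unitary N U -> Defs.orth_proj N P -> Defs.orth_proj N Pt ->
  (1 < gamma) -> (0 < delta < 1) -> (0 < eps < 1) ->
  (6 <= INR n * (delta / gamma)) -> (2 * (8 / 9) ^ r <= eps / gamma) ->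
  Defs.orthonormal_basis_of_img N P d v -> Defs.orthonormal_basis_of_img N Pt dt w ->
  (forall i, (i < Nat.min d dt)%coq_nat -> (0 <= s i)) ->
  Defs.mat_eq N N (Defs.mmul N (Defs.mmul N Pt U) P)
    (Defs.msum (Nat.min d dt) (fun i => Defs.mscale (Defs.RtoC (s i)) (Defs.outer (w i) (v i)))) ->
  let t := ((1 - delta) / gamma) in
  let s' := Defs.sig_ext (Nat.min d dt) s in
  let m := Nat.add (Nat.mul 2 (Nat.mul (Nat.add (Nat.mul 2 r) 1) (Nat.sub n 1))) 1 in
  exists (Phi : nat -> R) (st : nat -> R), Defs.mat_eq N N
    (Defs.mmul N (Defs.mmul N (Defs.thr_proj dt w s' t)
       (half_sum (Defs.UPhi N U P Pt m Phi) (Defs.UPhi N U P Pt m (fun j => Ropp (Phi j)))))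
       (Defs.thr_proj d v s' t))
    (Defs.msum (Nat.min d dt) (fun i => match Rle_dec (s' i) t with
       | left _ => Defs.mscale (Defs.RtoC (st i)) (Defs.outer (w i) (v i))
       | right _ => Defs.mzero
       end)) /\
    (forall i, (i < Nat.min d dt)%coq_nat -> (s' i <= t) ->
       (s' i = 0 -> st i = 0) /\
       ((0 < s' i) -> (Rabs (st i / (gamma * s' i) - 1) <= eps))).
Proof.
move=> uU oP oPt /RltP g1 [/RltP d0 /RltP d1] [/RltP e0 /RltP e1] /RleP nd /RleP rg bv bw s0 svd.
move=> t s' m.
have d01 : (0 < delta < 1)%R by rewrite d0 d1.
have e01 : (0 < eps < 1)%R by rewrite e0 e1.
have g0 : (0 < gamma)%R by rewrite (lt_trans ltr01).
have IZRE (p : positive) : IZR (Z.pos p) = ((Pos.to_nat p)%:R)%R.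
  by rewrite -INRE INR_IZR_INZ Znat.positive_nat_Z.
have [||us [sus uus ust]] := @amplifying_phases R gamma delta eps n r g1 d01 e01.
- by move: nd; rewrite !(INRE, RdivE, RmultE, IZRE).
- by move: rg; rewrite !(RpowE, RdivE, RmultE, IZRE).
have mE : m = size us by rewrite sus /m; clear; lia.
have oddus : odd (size us) by rewrite sus /= odd_double.
have [Phi H] := singular_value_transformation t uU oP oPt bv bw svd oddus uus.
exists Phi, (fun i => complex.Re (foldr (qsp_step ((s i)%:C)%C) (1, 0)%R us).1).
rewrite mE; split=> // i ir.
have -> : s' i = s i.
  by rewrite /s' /Defs.sig_ext; move/PeanoNat.Nat.ltb_lt: ir => ->.
have /RleP si0 := s0 i ir; move=> /RleP st.
have [|rho -> rho1] := ust (s i).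
  by rewrite si0 /=; move: st; rewrite /t !(RdivE, RminusE).
split=> [->|/RltP sp]; first by rewrite mulr0 mul0r.
apply/RleP; rewrite RabsE !(RdivE, RminusE, RmultE).
by rewrite mulrAC divff ?mul1r // mulf_neq0 // gt_eqF.
Qed.

End Amplification.

(** * Choice of the parameters and conclusion *)

Lemma nat_ceiling x : 0 <= x -> exists n : nat, x <= INR n <= x + 1.
Proof.
  intros Hx; destruct (archimed x) as [H1 H2].
  assert (Hz : (0 <= up x)%Z) by (apply le_IZR; lra).
  exists (Z.to_nat (up x)); rewrite INR_IZR_INZ, Z2Nat.id by assumption; lra.
Qed.

(** The [r]-th power of [1 - 1 / 9 <= exp (- 1 / 9)]. *)
Lemma pow_8_9_le_exp r : (8 / 9) ^ r <= exp (- (INR r / 9)).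
Proof.
  induction r as [|r IH].
  - simpl; replace (- (0 / 9)) with 0 by lra; rewrite exp_0; lra.
  - rewrite S_INR; replace (- ((INR r + 1) / 9)) with (- (1 / 9) + - (INR r / 9)) by lra.
    rewrite exp_plus; cbn [pow].
    pose proof (exp_ineq1_le (- (1 / 9))).
    apply Rmult_le_compat; try lra; apply pow_le; lra.
Qed.

Lemma amplification_parameters gamma delta eps :
  1 < gamma -> 0 < delta < 1/2 -> 0 < eps < 1/2 ->
  exists n r : nat,
    6 <= INR n * (delta / gamma) /\ 2 * (8 / 9) ^ r <= eps / gamma /\
    INR (2 * ((2 * r + 1) * (n - 1)) + 1) <= 1000 * (gamma / delta) * ln (gamma / eps).
Proof.
  intros Hg Hd He.
  set (g := gamma / delta); set (L := ln (gamma / eps)).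
  assert (Hge : 2 < gamma / eps).
  { apply (Rmult_lt_reg_r eps); [lra|]; unfold Rdiv; rewrite Rmult_assoc, Rinv_l; lra. }
  assert (HL : 1 / 2 < L).
  { apply Rlt_trans with (ln 2); [pose proof ln_lt_2; lra | apply ln_increasing; lra]. }
  assert (H2 : ln 2 < L) by (apply ln_increasing; lra).
  assert (Hgd : 2 < g).
  { apply (Rmult_lt_reg_r delta); [lra|]; unfold g, Rdiv; rewrite Rmult_assoc, Rinv_l; lra. }
  (* [n >= 6 g] meets the first inequality, and [r >= 9 (ln 2 + L)] makes [exp (- r / 9)] at most
     [eps / (2 gamma)]. *)
  destruct (nat_ceiling (6 * g)) as [n Hn]; [lra|].
  destruct (nat_ceiling (9 * (ln 2 + L))) as [r Hr].
  { pose proof ln_lt_2; lra. }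
  exists n, r; repeat split.
  - apply Rle_trans with (6 * g * (delta / gamma)).
    + apply Req_le; unfold g; field; lra.
    + apply Rmult_le_compat_r; [|lra].
      apply Rlt_le, Rdiv_lt_0_compat; lra.
  - apply Rle_trans with (2 * exp (- (ln 2 + L))).
    + apply Rmult_le_compat_l; [lra|].
      apply Rle_trans with (1 := pow_8_9_le_exp r).
      destruct (Rle_lt_or_eq_dec (ln 2 + L) (INR r / 9)) as [H|H]; [lra| |].
      * apply Rlt_le, exp_increasing; lra.
      * rewrite H; lra.
    + apply Req_le; unfold L; rewrite exp_Ropp, exp_plus, !exp_ln by lra.
      field; lra.
  - assert (Hn1 : (1 <= n)%nat).
    { destruct n; [simpl in Hn; lra | lia]. }
    apply Rle_trans with (INR (2 * (2 * r + 1) * n)).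
    + apply le_INR; nia.
    + rewrite !mult_INR, plus_INR, mult_INR; simpl INR.
      (* [L > 1 / 2] and [g > 2] absorb the additive constants: [2 r + 1 <= 36 L + 3 <= 42 L] and
         [n <= 6 g + 1 <= 7 g], and [2 * 42 * 7 = 588] is below 1000. *)
      assert (Ha : (1 + 1) * INR r + 1 <= 42 * L) by lra.
      assert (Hb : INR n <= 7 * g) by lra.
      pose proof (pos_INR r); pose proof (pos_INR n).
      apply Rle_trans with ((1 + 1) * (42 * L) * (7 * g)); [|nra].
      apply Rmult_le_compat; try nra.
Qed.

Theorem mainTheorem15 :
  exists Cst : R, 0 < Cst /\
  forall (N : nat) (U P Pt : Mat) (gamma delta eps : R)
         (d dt : nat) (v w : nat -> Vec) (s : nat -> R),
    unitary N U -> orth_proj N P -> orth_proj N Pt ->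
    1 < gamma -> 0 < delta < 1/2 -> 0 < eps < 1/2 ->
    orthonormal_basis_of_img N P d v ->
    orthonormal_basis_of_img N Pt dt w ->
    (forall i, (i < Nat.min d dt)%nat -> 0 <= s i) ->
    mat_eq N N (mmul N (mmul N Pt U) P)
      (msum (Nat.min d dt) (fun i => mscale (RtoC (s i)) (outer (w i) (v i)))) ->
    let t := (1 - delta) / gamma in
    let s' := sig_ext (Nat.min d dt) s in
    exists (m : nat) (Phi : nat -> R) (st : nat -> R),
      Nat.odd m = true /\
      INR m <= Cst * (gamma / delta) * ln (gamma / eps) /\
      mat_eq N N
        (mmul (2 * N)
           (mmul (2 * N) (kron N N braplus (thr_proj dt w s' t))
              (madd (kron N N proj0 (UPhi N U P Pt m Phi))
                    (kron N N proj1 (UPhi N U P Pt m (fun j => - Phi j)))))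
           (kron N N ketplus (thr_proj d v s' t)))
        (msum (Nat.min d dt) (fun i =>
           if Rle_dec (s' i) t then mscale (RtoC (st i)) (outer (w i) (v i)) else mzero)) /\
      (forall i, (i < Nat.min d dt)%nat -> s' i <= t ->
         (s' i = 0 -> st i = 0) /\
         (0 < s' i -> Rabs (st i / (gamma * s' i) - 1) <= eps)).
Proof.
  exists 1000; split; [lra|].
  intros N U P Pt gamma delta eps d dt v w s HU HP HPt Hg Hd He Hv Hw Hs Hsvd t s'.
  destruct (amplification_parameters gamma delta eps Hg Hd He) as (n & r & Hn & Hr & Hm).
  assert (Hd' : 0 < delta < 1) by lra.
  assert (He' : 0 < eps < 1) by lra.
  destruct (Amplification.singular_value_amplification
    HU HP HPt Hg Hd' He' Hn Hr Hv Hw Hs Hsvd) as (Phi & st & Hmat & Hst).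
  exists (2 * ((2 * r + 1) * (n - 1)) + 1)%nat, Phi, st.
  split; [apply Nat.odd_spec; eexists; reflexivity|].
  split; [exact Hm|].
  split; [|exact Hst].
  intros i j Hi Hj; rewrite plus_block by assumption.
  exact (Hmat i j Hi Hj).
Qed.
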